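(* Fix integers $k\ge 1$, $g\ge 1$, $T\ge 1$, groups $G_1,\dots,G_g\subseteq[k]$ and bounds $0\le\ell_i\le u_i\le1$, and let $$\mathcal C=\Big\{p\in\mathbb R^k:\ p\ge 0,\ \textstyle\sum_a p_a=1,\ \ell_i\le\sum_{a\in G_i}p_a\le u_i\ \ \forall i\in[g]\Big\}.$$ Let $\mu^\star\in[0,1]^k$ be the unknown mean-reward vector, and let $\sigma\ge 1$ with $\|\mu^\star\|_2\le\sigma$. Assume $\gamma>0$, where $\gamma$ is defined in the context. Let $\delta\in(0,1)$. Run the $L_1$-OFUL algorithm described in the context, with inputs $\mathcal C,\delta,\sigma,T$. Assume that for every $t$, conditionally on the past and on $p^t$, the reward $r_t$ has mean $\mu^{\star\top}p^t$ and $r_t-\mu^{\star\top}p^t$ is $1$-sub-Gaussian. Then with probability at least $1-\delta$, $$\mathsf{FairRegret}_T\le \frac{8k\sigma^2}{\gamma}\Big(\log T+(k-1)\log\frac{64\sigma^2}{\gamma^2}+2(k-1)\log\Big(k\log\big(1+\tfrac{T}{k}\big)+2\log\tfrac1\delta\Big)+2\log\tfrac1\delta\Big)^2 .$$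
   Context: Notation and definitions. - $V(\mathcal C)$ is the vertex set of $\mathcal C$, and $v^\star=\arg\max_{v\in V(\mathcal C)}\mu^{\star\top}v$ is assumed unique. - $\gamma:=\mu^{\star\top}v^\star-\max_{v\in V(\mathcal C)\setminus\{v^\star\}}\mu^{\star\top}v$. - $p^\star:=\arg\max_{p\in\mathcal C}\mu^{\star\top}p$. - The fair regret is $\mathsf{FairRegret}_T:=\sum_{t=1}^T\mu^{\star\top}(p^\star-p^t)$. - For a positive definite matrix $A$, $\|x\|_{1,A}:=\sum_i|(A^{1/2}x)_i|$. $L_1$-OFUL, with inputs $\mathcal C$, failure probability $\delta$, bound $\sigma$, horizon $T$: - Initialize $V_1=I_k$, $\hat\mu_1=0$, $b_1=0$. - For $t=1,\dots,T$: - set $\beta_t(\delta)=\big(\sqrt{2\log(\det(V_t)^{1/2}/\delta)}+\sigma\big)^2$; - let $B^1_t=\{\mu\in\mathbb R^k:\|\mu-\hat\mu_t\|_{1,V_t}\le\sqrt{k\beta_t(\delta)}\}$; - choose $p^t\in\arg\max_{p\in\mathcal C}\max_{\mu\in B^1_t}\mu^\top p$, taking $p^t$ to be a vertex of $\mathcal C$ (possible because the objective is convex in $p$); - sample an arm $a^t\sim p^t$ and observe the reward $r_t$; - update $V_{t+1}=V_t+p^tp^{t\top}$, $b_{t+1}=b_t+r_tp^t$, and $\hat\mu_{t+1}=V_{t+1}^{-1}b_{t+1}$. *)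

(* Defs.v *)
From HB Require Import structures.
From mathcomp Require Import all_boot all_order all_algebra.
From mathcomp Require Import all_classical all_reals all_analysis.
Set Implicit Arguments. Unset Strict Implicit. Unset Printing Implicit Defensive.
Import Order.TTheory GRing.Theory Num.Theory.
Local Open Scope classical_set_scope.
Local Open Scope ring_scope.

Section FairBandit.
Variables (R : realType) (k : nat).

Definition dotv (u v : 'cV[R]_k) : R := \sum_(i < k) u i 0 * v i 0.

Definition norm2 (u : 'cV[R]_k) : R := Num.sqrt (\sum_(i < k) u i 0 ^+ 2).

Definition psdmx (S : 'M[R]_k) : Prop :=
  S^T = S /\ forall x : 'cV[R]_k, 0 <= (x^T *m S *m x) 0 0.

(* the (unique) PSD square root A^{1/2} of a PSD matrix A *)
Definition sqrtmx (A : 'M[R]_k) : 'M[R]_k :=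
  xget 0 [set S | psdmx S /\ S *m S = A].

Definition norm1A (A : 'M[R]_k) (x : 'cV[R]_k) : R :=
  \sum_(i < k) `|(sqrtmx A *m x) i 0|.

Definition fairC (g : nat) (G : 'I_g -> {set 'I_k}) (lo up : 'I_g -> R)
  : set 'cV[R]_k :=
  [set p | (forall a, 0 <= p a 0) /\ \sum_(a < k) p a 0 = 1 /\
           forall i, lo i <= \sum_(a in G i) p a 0 <= up i].

Definition vertex (C : set 'cV[R]_k) (p : 'cV[R]_k) : Prop :=
  C p /\ forall x y : 'cV[R]_k, C x -> C y -> forall l : R, 0 < l < 1 ->
    p = l *: x + (1 - l) *: y -> x = y.

Definition gap (C : set 'cV[R]_k) (mu vstar : 'cV[R]_k) : R :=
  dotv mu vstar - sup [set dotv mu v | v in [set v | vertex C v /\ v <> vstar]].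

(* L1-OFUL quantities at round t (t >= 1), given the played vectors
   p 1, ..., p (t-1) and rewards r 1, ..., r (t-1). *)
Definition Vmat (p : nat -> 'cV[R]_k) (t : nat) : 'M[R]_k :=
  1%:M + \sum_(1 <= s < t) (p s *m (p s)^T).

Definition bvec (p : nat -> 'cV[R]_k) (r : nat -> R) (t : nat) : 'cV[R]_k :=
  \sum_(1 <= s < t) (r s *: p s).

Definition muhat (p : nat -> 'cV[R]_k) (r : nat -> R) (t : nat) : 'cV[R]_k :=
  invmx (Vmat p t) *m bvec p r t.

Definition beta (delta sigma : R) (V : 'M[R]_k) : R :=
  (Num.sqrt (2 * ln (Num.sqrt (\det V) / delta)) + sigma) ^+ 2.

Definition ball1 (V : 'M[R]_k) (mh : 'cV[R]_k) (rad : R) : set 'cV[R]_k :=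
  [set mu | norm1A V (mu - mh) <= rad].

Definition optval (B : set 'cV[R]_k) (q : 'cV[R]_k) : R :=
  sup [set dotv mu q | mu in B].

Definition oful_choice (C : set 'cV[R]_k) (delta sigma : R)
  (p : nat -> 'cV[R]_k) (r : nat -> R) (t : nat) : Prop :=
  let V := Vmat p t in
  let B := ball1 V (muhat p r t) (Num.sqrt (k%:R * beta delta sigma V)) in
  vertex C (p t) /\ forall q, C q -> optval B q <= optval B (p t).

Definition fair_regret (mu pstar : 'cV[R]_k) (p : nat -> 'cV[R]_k) (T : nat) : R :=
  \sum_(1 <= t < T.+1) dotv mu (pstar - p t).

End FairBandit.

(* Main.v *)
Require Import Defs.
From HB Require Import structures.
From mathcomp Require Import all_boot all_order all_algebra.
From mathcomp Require Import all_classical all_reals all_analysis.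
From mathcomp Require Import complex measurable_realfun.
From mathcomp Require Import ring lra zify.
Import Order.TTheory GRing.Theory Num.Theory.
Local Open Scope classical_set_scope.
Local Open Scope ring_scope.

(* Let S_t be the noise-weighted sum of the played vectors and L = ln det V_{T+1}.

   Confidence: M_t = exp(|S_t|^2_{V_t^-1} / 2) / sqrt(det V_t) is a nonnegative
   supermartingale.  By the Sherman-Morrison formula the factor M_{t+1} / M_t is
   the integral of exp(l e - l^2 / 2) against the one-dimensional Gaussian
   N(a, c) in l, where e is the noise, a = p_t^T V_t^-1 S_t and
   c = p_t^T V_t^-1 p_t, so Tonelli and sub-Gaussianity at each fixed l suffice.
   The maximal inequality bounds M_t by 1/delta for all t <= T.

   Regret: since |.|_2 <= |.|_1 <= sqrt k |.|_2, optimism and Cauchy-Schwarz bound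
   the regret of a round by (sqrt k + 1) sqrt(beta) |p_t|_{V_t^-1}.  A suboptimal
   vertex costs at least gamma, so both gamma times the regret and gamma^2 N,
   where N counts the suboptimal rounds, are at most (9/2) k beta L.

   Determinant: all but N rounds play v*, so shrinking the direction of v* before
   applying AM-GM gives det V_{T+1} <= (1 + T) (1 + N / (k-1))^(k-1), which has
   the exponent 1 on T.  Feeding the bound on N back yields
   L + 2 log(1/delta) + 9/16 <= X, the quantity squared in the theorem, and
   (9/2) L (sqrt y + 1)^2 <= 8 (y + 9/16)^2 for y = L + 2 log(1/delta). *)

(** * Vectors, rank-one updates and the design matrix *)

Section DotProduct.
Context {R : realType} {k : nat}.
Implicit Types (u v x y z : 'cV[R]_k) (A V : 'M[R]_k).

Lemma dotvE u v : dotv u v = (u^T *m v) 0 0.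
Proof. by rewrite mxE; apply: eq_bigr => i _; rewrite mxE. Qed.

Lemma mulmx_dotv u v : u^T *m v = (dotv u v)%:M.
Proof. by rewrite [LHS]mx11_scalar dotvE. Qed.

Lemma dotvC u v : dotv u v = dotv v u.
Proof. by apply: eq_bigr => i _; rewrite mulrC. Qed.

Lemma dotvDr u v x : dotv u (v + x) = dotv u v + dotv u x.
Proof. by rewrite /dotv -big_split; apply: eq_bigr => i _; rewrite mxE mulrDr. Qed.

Lemma dotvZr a u v : dotv u (a *: v) = a * dotv u v.
Proof. by rewrite /dotv mulr_sumr; apply: eq_bigr => i _; rewrite mxE mulrCA. Qed.

Lemma dotvNr u v : dotv u (- v) = - dotv u v.
Proof. by rewrite -scaleN1r dotvZr mulN1r. Qed.

Lemma dotvBr u v x : dotv u (v - x) = dotv u v - dotv u x.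
Proof. by rewrite dotvDr dotvNr. Qed.

Lemma dotvDl u v x : dotv (v + x) u = dotv v u + dotv x u.
Proof. by rewrite dotvC dotvDr !(dotvC u). Qed.

Lemma dotvZl a u v : dotv (a *: v) u = a * dotv v u.
Proof. by rewrite dotvC dotvZr (dotvC u). Qed.

Lemma dotvBl u v x : dotv (v - x) u = dotv v u - dotv x u.
Proof. by rewrite dotvC dotvBr !(dotvC u). Qed.

Lemma dotv_mulmxr A u v : dotv u (A *m v) = dotv (A^T *m u) v.
Proof. by rewrite !dotvE trmx_mul trmxK mulmxA. Qed.

Lemma dotv_mulmxl A u v : dotv (A *m u) v = dotv u (A^T *m v).
Proof. by rewrite dotv_mulmxr trmxK. Qed.

Lemma dotv_ge0 u : 0 <= dotv u u.
Proof. by apply: sumr_ge0 => i _; rewrite -expr2 sqr_ge0. Qed.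

Lemma dotv_eq0 u : dotv u u = 0 -> u = 0.
Proof.
move=> /psumr_eq0P u0; apply/colP => i; rewrite mxE; apply/eqP.
by rewrite -sqrf_eq0 expr2; apply/eqP/u0 => // j _; rewrite -expr2 sqr_ge0.
Qed.

Lemma norm2E u : norm2 u = Num.sqrt (dotv u u).
Proof. by congr Num.sqrt; apply: eq_bigr => i _; rewrite expr2. Qed.

Lemma norm2_ge0 u : 0 <= norm2 u.
Proof. exact: sqrtr_ge0. Qed.

Lemma norm2_sqr u : norm2 u ^+ 2 = dotv u u.
Proof. by rewrite norm2E sqr_sqrtr ?dotv_ge0. Qed.

Lemma dotv_sqr_le u v : dotv u v ^+ 2 <= dotv u u * dotv v v.
Proof.
have [v0|v_neq0] := eqVneq (dotv v v) 0.
  have -> : dotv u v = 0.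
    by rewrite (dotv_eq0 _ v0) -(scale0r 0) dotvZr mul0r.
  by rewrite v0 expr0n mulr0.
have v_gt0 : 0 < dotv v v by rewrite lt_neqAle eq_sym v_neq0 dotv_ge0.
(* This square equals [dotv v v] times the difference of the two sides. *)
have := dotv_ge0 (dotv v v *: u - dotv u v *: v).
rewrite dotvBl !dotvBr !dotvZl !dotvZr (dotvC v u) => h.
rewrite -(ler_pM2l v_gt0) -subr_ge0; apply: le_trans h _.
by rewrite le_eqVlt; apply/orP; left; apply/eqP; ring.
Qed.

Lemma dotv_le_norm2 u v : `|dotv u v| <= norm2 u * norm2 v.
Proof.
rewrite -(@ler_pXn2r _ 2) ?nnegrE ?mulr_ge0 ?norm2_ge0 ?normr_ge0 //.
by rewrite exprMn !norm2_sqr -normrX ger0_norm ?sqr_ge0 ?dotv_sqr_le.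
Qed.

Lemma norm2D u v : norm2 (u + v) <= norm2 u + norm2 v.
Proof.
rewrite -(@ler_pXn2r _ 2) ?nnegrE ?addr_ge0 ?norm2_ge0 //.
rewrite sqrrD !norm2_sqr dotvDl !dotvDr (dotvC v u).
have := le_trans (ler_norm _) (dotv_le_norm2 u v).
by rewrite mulr2n; lra.
Qed.

Lemma norm2N u : norm2 (- u) = norm2 u.
Proof. by rewrite !norm2E dotvNr dotvC dotvNr opprK. Qed.

Lemma norm2_le_norm1 u : norm2 u <= \sum_(i < k) `|u i 0|.
Proof.
rewrite -(@ler_pXn2r _ 2) ?nnegrE ?norm2_ge0 ?sumr_ge0 //.
rewrite norm2_sqr /dotv expr2 mulr_suml; apply: ler_sum => i _.
rewrite -expr2 -real_normK ?num_real // expr2 ler_wpM2l //.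
by rewrite (bigD1 i) //= lerDl sumr_ge0.
Qed.

(** Cauchy-Schwarz against the all-ones vector. The factor [Num.sqrt k%:R] is the one by which the
    radius of the L1 ball is enlarged. *)
Lemma norm1_le_norm2 u : \sum_(i < k) `|u i 0| <= Num.sqrt k%:R * norm2 u.
Proof.
have := dotv_le_norm2 (\col_i 1) (\col_i `|u i 0|).
have -> : dotv (\col_i 1) (\col_i `|u i 0|) = \sum_(i < k) `|u i 0|.
  by apply: eq_bigr => i _; rewrite !mxE mul1r.
have -> : norm2 (\col_i `|u i 0|) = norm2 u.
  by congr Num.sqrt; apply: eq_bigr => i _; rewrite mxE real_normK ?num_real.
have -> : norm2 (\col_(_ < k) (1 : R)) = Num.sqrt k%:R.
  congr Num.sqrt; rewrite (eq_bigr (fun=> 1)) ?sumr_const ?card_ord //.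
  by move=> i _; rewrite mxE expr1n.
by apply: le_trans; exact: ler_norm.
Qed.

End DotProduct.

(** * Determinant and inverse under rank-one updates *)

Section RankOne.
Context {R : realType} {k : nat}.
Implicit Types (u v x y z : 'cV[R]_k) (A V : 'M[R]_k).

Lemma mul_col_rowE x y z : (x *m y^T) *m z = dotv y z *: x.
Proof. by rewrite -mulmxA mulmx_dotv mul_mx_scalar. Qed.

(** Unipotent block factors on both sides turn one block-triangular matrix into another; comparing
    determinants gives the identity. *)
Lemma det1D_rank1 x y : \det (1%:M + x *m y^T) = 1 + dotv y x.
Proof.
have e : block_mx 1%:M 0 y^T 1%:M *m block_mx (1%:M + x *m y^T) x 0 1%:M
    *m block_mx 1%:M 0 (- y^T) 1%:M = block_mx 1%:M x 0 (1 + dotv y x)%:M.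
  rewrite !mulmx_block !(mulmx1, mul1mx, mulmx0, mul0mx, addr0, add0r).
  rewrite mulmxN addrK mulmxN mulmxDl mulmxDr mulmx1 mul1mx !mulmxA.
  rewrite [y^T + _]addrC subrr.
  by rewrite mulmx_dotv addrC (rmorphD (@scalar_mx R 1)).
move/(congr1 determinant): e.
by rewrite !det_mulmx !det_lblock !det_ublock !det1 !(mul1r, mulr1) det_scalar1.
Qed.

Lemma det_add_rank1 A x : A \in unitmx ->
  \det (A + x *m x^T) = \det A * (1 + dotv x (invmx A *m x)).
Proof.
move=> uA; rewrite -det1D_rank1 -det_mulmx mulmxDr mulmx1 !mulmxA.
by rewrite mulmxV // mul1mx.
Qed.

(** The Sherman-Morrison formula, checked by multiplying both sides by [A + x *m x^T]. *)
Lemma invmx_add_rank1 A x : A \in unitmx -> 1 + dotv x (invmx A *m x) != 0 ->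
  invmx (A + x *m x^T) = invmx A
    - (1 + dotv x (invmx A *m x))^-1 *: (invmx A *m x *m (x^T *m invmx A)).
Proof.
move=> uA c_neq0; set c := dotv _ _ in c_neq0 *.
have uB : A + x *m x^T \in unitmx.
  by rewrite unitmxE det_add_rank1 // unitrM -unitmxE uA unitfE.
apply: (can_inj (mulKmx uB)); rewrite mulmxV //.
rewrite mulmxDr mulmxN -scalemxAr !mulmxDl mulmxV // !mulmxA mulmxV // mul1mx.
have -> : x *m x^T *m invmx A *m x = c *: x by rewrite -!mulmxA mulmx_dotv mul_mx_scalar.
rewrite -scalemxAl -scalemxAl -[X in _ *: (X + _)]scale1r -scalerDl scalerA.
by rewrite mulVf // scale1r addrK.
Qed.

End RankOne.

(** * The design matrix and its inverse quadratic form *)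

Section DesignMatrix.
Context {R : realType} {k : nat}.
Implicit Types (p : nat -> 'cV[R]_k) (r : nat -> R) (t : nat) (x y : 'cV[R]_k).

Lemma Vmat1 p : Vmat p 1 = 1%:M.
Proof. by rewrite /Vmat big_geq ?addr0. Qed.

Lemma VmatS p t : (0 < t)%N -> Vmat p t.+1 = Vmat p t + p t *m (p t)^T.
Proof. by move=> t0; rewrite /Vmat big_nat_recr //= addrA. Qed.

Lemma tr_Vmat p t : (Vmat p t)^T = Vmat p t.
Proof.
rewrite /Vmat raddfD /= trmx1 raddf_sum /=; congr (_ + _).
by apply: eq_bigr => s _; rewrite trmx_mul trmxK.
Qed.

Lemma Vmat_ge p t x : dotv x x <= dotv x (Vmat p t *m x).
Proof.
rewrite /Vmat mulmxDl mul1mx dotvDr lerDl dotvE mulmx_suml mulmx_sumr summxE.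
apply: sumr_ge0 => s _; rewrite -dotvE mul_col_rowE dotvZr dotvC -expr2.
exact: sqr_ge0.
Qed.

(** A row vector [u] in the kernel satisfies [|u|^2 <= u V u^T = 0], by [Vmat_ge]. *)
Lemma Vmat_unit p t : Vmat p t \in unitmx.
Proof.
rewrite -row_free_unit; apply/row_freeP.
suff : kermx (Vmat p t) = 0.
  by move/eqP; rewrite kermx_eq0 => /row_freeP.
apply/row_matrixP => i; rewrite row0; set u := row i _.
have uV : u *m Vmat p t = 0 by apply/sub_kermxP; exact: row_sub.
have : dotv u^T (Vmat p t *m u^T) = 0.
  by rewrite dotvE mulmxA trmxK uV mul0mx mxE.
have := Vmat_ge p t u^T; have := dotv_ge0 u^T.
move=> h1 h2 h3; rewrite h3 in h2.
have /dotv_eq0 : dotv u^T u^T = 0 by apply/eqP; rewrite eq_le h2.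
by move/(congr1 trmx); rewrite trmxK trmx0.
Qed.

Lemma tr_invVmat p t : (invmx (Vmat p t))^T = invmx (Vmat p t).
Proof. by rewrite trmx_inv tr_Vmat. Qed.

(** The squared norm of [x] in the metric of [V_t^-1]: the uncertainty in the direction [x] and, at
    the noise sum, twice the exponent of the supermartingale. *)
Definition Vwidth p t x := dotv x (invmx (Vmat p t) *m x).

Lemma Vwidth_ge p t x (z := invmx (Vmat p t) *m x) : dotv z z <= Vwidth p t x.
Proof.
have -> : Vwidth p t x = dotv z (Vmat p t *m z).
  by rewrite dotvC /z mulKVmx ?Vmat_unit.
exact: Vmat_ge.
Qed.

Lemma Vwidth_ge0 p t x : 0 <= Vwidth p t x.
Proof. exact: le_trans (dotv_ge0 _) (Vwidth_ge p t x). Qed.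

Lemma Vwidth_gt0 p t x : x != 0 -> 0 < Vwidth p t x.
Proof.
move=> x0; rewrite lt_neqAle Vwidth_ge0 andbT; apply: contra_neq x0 => w0.
have := Vwidth_ge p t x; rewrite -w0 => zle.
have /dotv_eq0 /(congr1 (mulmx (Vmat p t))) :
    dotv (invmx (Vmat p t) *m x) (invmx (Vmat p t) *m x) = 0.
  by apply/eqP; rewrite eq_le zle dotv_ge0.
by rewrite mulKVmx ?Vmat_unit // mulmx0.
Qed.

(** Expand [|x - V^-1 x|^2 >= 0] and bound [|V^-1 x|^2] by the width itself. *)
Lemma Vwidth_le p t x : Vwidth p t x <= dotv x x.
Proof.
have := dotv_ge0 (x - invmx (Vmat p t) *m x); have := Vwidth_ge p t x.
rewrite dotvBl !dotvBr (dotvC (_ *m _) x) /Vwidth; set a := dotv x (_ *m _); lra.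
Qed.

Lemma det_VmatS p t : (0 < t)%N ->
  \det (Vmat p t.+1) = \det (Vmat p t) * (1 + Vwidth p t (p t)).
Proof. by move=> t0; rewrite VmatS // det_add_rank1 // Vmat_unit. Qed.

Lemma det_Vmat_ge1 p t : 1 <= \det (Vmat p t).
Proof.
elim: t => [|[|t] IH].
- by rewrite /Vmat big_geq // addr0 det1.
- by rewrite Vmat1 det1.
by rewrite det_VmatS // (le_trans IH) // ler_peMr ?(le_trans ler01) // lerDl Vwidth_ge0.
Qed.

Lemma det_Vmat_gt0 p t : 0 < \det (Vmat p t).
Proof. exact: lt_le_trans ltr01 (det_Vmat_ge1 p t). Qed.

Lemma det_Vmat_le p t t' : (0 < t)%N -> (t <= t')%N ->
  \det (Vmat p t) <= \det (Vmat p t').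
Proof.
move=> t0 /subnKC <-; elim: (t' - t)%N => [|n IH]; first by rewrite addn0.
rewrite addnS det_VmatS ?addn_gt0 ?t0 //; apply: le_trans IH _.
by rewrite ler_peMr ?(ltW (det_Vmat_gt0 _ _)) // lerDl Vwidth_ge0.
Qed.

(** The potential identity that later converts the sum of squared round regrets into a
    log-determinant. *)
Lemma ln_det_Vmat p t :
  ln (\det (Vmat p t.+1)) = \sum_(1 <= s < t.+1) ln (1 + Vwidth p s (p s)).
Proof.
elim: t => [|t IH]; first by rewrite big_geq // Vmat1 det1 ln1.
rewrite big_nat_recr //= -IH det_VmatS // lnM // posrE ?det_Vmat_gt0 //.
by rewrite ltr_pwDl ?Vwidth_ge0.
Qed.

Lemma tr_Vmat_sum p t : \tr (Vmat p t) = k%:R + \sum_(1 <= s < t) dotv (p s) (p s).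
Proof.
rewrite /Vmat mxtraceD mxtrace1 raddf_sum /=; congr (_ + _).
by apply: eq_bigr => s _; rewrite mxtrace_mulC mulmx_dotv mxtrace_scalar.
Qed.

End DesignMatrix.

(** * Positive semidefinite square roots *)

Section Spectral.
Context {R : realType}.
Import complex.
Local Notation toC := (real_complex R).

Lemma ReM_real_conj (a b : R[i]) (v : R) :
  Re (a * v%:C%C * Num.conj b) = v * (Re a * Re b + Im a * Im b).
Proof. by case: a => a1 a2; case: b => b1 b2; simpc => /=; ring. Qed.

(* The real spectral theorem, in the only form needed: eigenvalues listed in
   [x], and vanishing of polynomials in [V] tested on the spectrum. *)
Lemma psdmx_spectrum k (V : 'M[R]_k.+1) : psdmx V ->
  exists x : 'I_k.+1 -> R, [/\ forall i, 0 <= x i, \det V = \prod_i x i,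
    \tr V = \sum_i x i &
    forall q : {poly R}, (forall i, q.[x i] = 0) -> horner_mx V q = 0].
Proof.
move=> [Vsym Vpsd]; pose A := map_mx toC V.
(* Over the complex numbers a real symmetric matrix is Hermitian, so a unitary [U] diagonalizes it
   with a real spectrum [D]. *)
have Asym : A \is symmetricmx.
  by apply/is_hermitianmxP; rewrite expr0 scale1r map_mx_id // matrix.map_trmx Vsym.
have Areal : A \is a mxOver Num.real.
  by apply/mxOverP => i j; rewrite mxE complex_real.
have Aherm : A \is hermsymmx by exact: realsym_hermsym.
have /orthomx_spectralP := hermitian_normalmx Aherm.
set U := spectralmx A; set D := spectral_diag A => Aeq.
have Uu : U \is unitarymx := spectral_unitarymx A.
have Uunit : U \in unitmx := spectral_unit A.
have Dreal : D \is a mxOver Num.real := hermitian_spectral_diag_real Aherm.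
have DE i : D 0 i = (Re (D 0 i))%:C%C.
  have /mxOverP/(_ 0 i) := Dreal; move=> /complex_realP[y ->].
  by [].
have UAU : U *m A *m map_mx Num.conj U^T = diag_mx D.
  by rewrite Aeq -(invmx_unitary Uu) !mulmxA mulmxV // mul1mx mulmxK.
exists (fun i => Re (D 0 i)); split.
- move=> i; have /matrixP/(_ i i) := UAU; rewrite [RHS]mxE eqxx mulr1n => <-.
  rewrite mxE raddf_sum /=.
  (* An eigenvalue is the Hermitian form at a row of [U], that is, the sum of the real quadratic
     forms at the real and imaginary parts of that row. *)
  have -> : \sum_l Re ((U *m A) i l * map_mx Num.conj U^T l i) =
      dotv (\col_j Re (U i j)) (V *m \col_j Re (U i j))
      + dotv (\col_j Im (U i j)) (V *m \col_j Im (U i j)).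
    rewrite !(dotvC _ (V *m _)) /dotv -big_split; apply: eq_bigr => l _ /=.
    rewrite !mxE !mulr_suml raddf_sum -big_split; apply: eq_bigr => j _ /=.
    rewrite !mxE ReM_real_conj -[in RHS]Vsym !mxE; ring.
  by rewrite addr_ge0 // dotvE mulmxA.
- apply: (fmorph_inj toC); rewrite -det_map_mx rmorph_prod /= -/A Aeq.
  rewrite !det_mulmx det_inv mulrC mulrA divrr -?unitmxE // mul1r det_diag.
  by apply: eq_bigr => i _; rewrite -DE.
- apply: (fmorph_inj toC); rewrite -trace_map_mx raddf_sum /= -/A Aeq.
  rewrite mxtrace_mulC mulmxA mulmxV // mul1mx mxtrace_diag.
  by apply: eq_bigr => i _; rewrite -DE.
- move=> q q0; apply: (map_mx_inj (f := toC)); rewrite map_horner_mx -/A Aeq.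
  rewrite horner_mx_uconjC // horner_mx_diag map_mx0.
  suff -> : map_mx (horner (map_poly toC q)) D = 0.
    by rewrite (raddf0 (@diag_mx _ _)) mulmx0 mul0mx.
  by apply/rowP => i; rewrite !mxE DE horner_map q0.
Qed.

(** Induction on the nodes: a new node is corrected by a multiple of the polynomial that vanishes on
    the earlier ones. *)
Lemma poly_interpolation (s : seq R) (f : R -> R) :
  exists q : {poly R}, {in s, forall x, q.[x] = f x}.
Proof.
elim: s => [|y s [q qE]]; first by exists 0.
have [ys|yNs] := boolP (y \in s).
  by exists q => x; rewrite inE => /predU1P[->|]; exact: qE.
pose w : {poly R} := \prod_(z <- s) ('X - z%:P).
have wy : w.[y] != 0.
  by rewrite -/(root w y) root_prod_XsubC.
exists (q + ((f y - q.[y]) / w.[y]) *: w) => x; rewrite inE !hornerE.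
move=> /predU1P[->|xs]; first by rewrite divfK // addrC subrK.
have /eqP -> : root w x by rewrite root_prod_XsubC.
by rewrite mulr0 addr0 qE.
Qed.

Lemma tr_horner_mx k (V : 'M[R]_k.+1) (q : {poly R}) :
  V^T = V -> (horner_mx V q)^T = horner_mx V q.
Proof.
move=> Vsym; elim/poly_ind: q => [|q c IH]; first by rewrite !rmorph0 trmx0.
rewrite !(rmorphD, rmorphM) /= horner_mx_X horner_mx_C [LHS]raddfD /=.
rewrite tr_scalar_mx trmx_mul IH Vsym; congr (_ + _).
exact/esym/(comm_horner_mx _ (comm_mx_refl V)).
Qed.

(** Let [q] interpolate the fourth root on the spectrum and put [B = q(V)]. As [B] is symmetric,
    [B *m B] is positive semidefinite, and [B^4 = V] because [q^4 - X] vanishes on the spectrum.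
    With this witness [xget] returns an element of the set. *)
Lemma sqrtmxP k (V : 'M[R]_k) : psdmx V ->
  psdmx (sqrtmx V) /\ sqrtmx V *m sqrtmx V = V.
Proof.
case: k V => [|k] V Vpsd.
  apply: (@xgetPex _ 0 [set S | psdmx S /\ S *m S = V]); exists V.
  by split => //; rewrite [LHS]thinmx0 [RHS]thinmx0.
have [x [x_ge0 _ _ spec]] := @psdmx_spectrum _ V Vpsd.
have [q qE] := poly_interpolation (codom x) (fun y => Num.sqrt (Num.sqrt y)).
apply: (@xgetPex _ 0 [set S | psdmx S /\ S *m S = V]).
pose B := horner_mx V q.
have Bsym : B^T = B by rewrite /B tr_horner_mx //; case: Vpsd.
exists (B *m B); split; first split.
- by rewrite trmx_mul Bsym.
- by move=> y; rewrite -!mulmxA mulmxA -{1}Bsym -trmx_mul -dotvE dotv_ge0.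
- have := spec (q ^+ 4 - 'X); rewrite rmorphB rmorphXn /= horner_mx_X => /(_ _)/subr0_eq <-.
    by rewrite -/B -!mulmxA !exprS expr0 mulr1.
  move=> i; rewrite !hornerE qE ?codom_f //.
  by rewrite (exprM _ 2 2) !sqr_sqrtr ?sqrtr_ge0 // subrr.
Qed.

(** AM-GM for the eigenvalues. *)
Lemma det_le_tr k (V : 'M[R]_k) : (0 < k)%N -> psdmx V ->
  \det V <= (\tr V / k%:R) ^+ k.
Proof.
case: k V => // k V _ /psdmx_spectrum[x [x_ge0 -> -> _]].
have := leif_AGM (A := [pred i : 'I_k.+1 | true]) (E := x) (fun i _ => x_ge0 i).
by rewrite (eq_card (B := 'I_k.+1)) // card_ord => -[].
Qed.

End Spectral.

(** * Confidence sets and the regret of one round *)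

Section Confidence.
Context {R : realType} {k : nat}.
Implicit Types (p : nat -> 'cV[R]_k) (r : nat -> R) (mu x : 'cV[R]_k).

Lemma psd_Vmat p t : psdmx (Vmat p t).
Proof.
split; first exact: tr_Vmat.
move=> x; rewrite -mulmxA -dotvE; exact: le_trans (dotv_ge0 _) (Vmat_ge _ _ _).
Qed.

Lemma tr_sqrtVmat p t : (sqrtmx (Vmat p t))^T = sqrtmx (Vmat p t).
Proof. by have [[]] := sqrtmxP _ _ (psd_Vmat p t). Qed.

Lemma mul_sqrtVmat p t : sqrtmx (Vmat p t) *m sqrtmx (Vmat p t) = Vmat p t.
Proof. by have [] := sqrtmxP _ _ (psd_Vmat p t). Qed.

Lemma sqrtVmat_unit p t : sqrtmx (Vmat p t) \in unitmx.
Proof.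
by have := Vmat_unit p t; rewrite -{1}mul_sqrtVmat unitmx_mul andbb.
Qed.

Lemma norm2_invsqrtVmat p t x :
  norm2 (invmx (sqrtmx (Vmat p t)) *m x) = Num.sqrt (Vwidth p t x).
Proof.
have -> : Vwidth p t x = dotv x (invmx (sqrtmx (Vmat p t)) *m
    (invmx (sqrtmx (Vmat p t)) *m x)).
  congr dotv; apply: (can_inj (mulKmx (Vmat_unit p t))).
  rewrite mulKVmx ?Vmat_unit // -{1}mul_sqrtVmat -mulmxA.
  by rewrite !mulKVmx ?sqrtVmat_unit.
by rewrite norm2E dotv_mulmxl trmx_inv tr_sqrtVmat.
Qed.

(** Cauchy-Schwarz for [V^(1/2) x] and [V^(-1/2) q]. *)
Lemma dotv_le_Vwidth p t x q :
  `|dotv x q| <= norm2 (sqrtmx (Vmat p t) *m x) * Num.sqrt (Vwidth p t q).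
Proof.
apply: le_trans (_ : `|dotv (sqrtmx (Vmat p t) *m x)
    (invmx (sqrtmx (Vmat p t)) *m q)| <= _).
  by rewrite dotv_mulmxl tr_sqrtVmat mulKVmx ?sqrtVmat_unit.
by rewrite -norm2_invsqrtVmat dotv_le_norm2.
Qed.

Definition noise mu p r (s : nat) : R := r s - dotv mu (p s).

Definition noise_sum mu p r t : 'cV[R]_k := \sum_(1 <= s < t) noise mu p r s *: p s.

Lemma noise_sumS mu p r t : (0 < t)%N ->
  noise_sum mu p r t.+1 = noise_sum mu p r t + noise mu p r t *: p t.
Proof. by move=> t0; rewrite /noise_sum big_nat_recr. Qed.

(** Multiply by [V]: its rank-one terms turn rewards into noise, and its identity term leaves the
    regularization bias [- mu]. *)
Lemma muhatB mu p r t :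
  muhat p r t - mu = invmx (Vmat p t) *m (noise_sum mu p r t - mu).
Proof.
apply: (can_inj (mulKmx (Vmat_unit p t))).
rewrite mulKVmx ?Vmat_unit // mulmxBr /muhat mulKVmx ?Vmat_unit //.
rewrite /noise_sum /Vmat mulmxDl mul1mx mulmx_suml opprD [- mu - _]addrC addrA.
congr (_ - _); rewrite /bvec -sumrB; apply: eq_bigr => s _.
by rewrite mul_col_rowE -scalerBl /noise (dotvC mu).
Qed.

(** Triangle inequality for [V^(-1/2) S - V^(-1/2) mu]. The second term is at most [norm2 mu]
    because [V] dominates the identity; this accounts for [sigma] in [beta]. *)
Lemma confidence_ellipsoid mu p r t delta sigma : norm2 mu <= sigma ->
  Vwidth p t (noise_sum mu p r t) <= 2 * ln (Num.sqrt (\det (Vmat p t)) / delta) ->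
  norm2 (sqrtmx (Vmat p t) *m (muhat p r t - mu))
    <= Num.sqrt (beta delta sigma (Vmat p t)).
Proof.
move=> mu_le w_le; have sigma_ge0 := le_trans (norm2_ge0 mu) mu_le.
rewrite muhatB /beta sqrtr_sqr ger0_norm ?addr_ge0 ?sqrtr_ge0 //.
have -> : sqrtmx (Vmat p t) *m (invmx (Vmat p t) *m (noise_sum mu p r t - mu))
    = invmx (sqrtmx (Vmat p t)) *m noise_sum mu p r t
      + - (invmx (sqrtmx (Vmat p t)) *m mu).
  apply: (can_inj (mulKmx (sqrtVmat_unit p t))).
  rewrite mulmxA mul_sqrtVmat mulKVmx ?Vmat_unit // mulmxDr mulmxN.
  by rewrite !mulKVmx ?sqrtVmat_unit.
apply: le_trans (norm2D _ _) _; rewrite norm2N !norm2_invsqrtVmat lerD //.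
  exact: ler_wsqrtr.
apply: le_trans mu_le; rewrite norm2E; exact/ler_wsqrtr/Vwidth_le.
Qed.

(** Optimism: [mu] lies in the ball, so its value at [q] is at most the optimistic value at [p t].
    The latter exceeds the value of the estimate by at most the L1 radius times the root of the
    width, and passing from the estimate to [mu] costs one more [Num.sqrt b]. *)
Lemma round_regret mu p r t delta sigma C q :
  oful_choice C delta sigma p r t -> C q ->
  norm2 (sqrtmx (Vmat p t) *m (muhat p r t - mu))
    <= Num.sqrt (beta delta sigma (Vmat p t)) ->
  dotv mu (q - p t) <= (Num.sqrt k%:R + 1) *
    Num.sqrt (beta delta sigma (Vmat p t)) * Num.sqrt (Vwidth p t (p t)).
Proof.
set V := Vmat p t; set b := beta delta sigma V; set m := muhat p r t.
move=> [_ choice] Cq conf.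
have radE : Num.sqrt (k%:R * b) = Num.sqrt k%:R * Num.sqrt b by rewrite sqrtrM.
pose B := ball1 V m (Num.sqrt (k%:R * b)).
have Bmu : B mu.
  rewrite /B /ball1 /= /norm1A radE -opprB mulmxN.
  apply: le_trans (norm1_le_norm2 _) _.
  by rewrite norm2N ler_wpM2l ?sqrtr_ge0.
(* The L2 norm is below the L1 norm, so values over the ball are bounded above and [sup] is a
   genuine supremum. *)
have Bub y : ubound [set dotv nu y | nu in B]
    (dotv m y + Num.sqrt (k%:R * b) * Num.sqrt (Vwidth p t y)).
  move=> _ [nu Bnu <-]; rewrite -lerBlDl -dotvBl.
  apply: le_trans (ler_norm _) _; apply: le_trans (dotv_le_Vwidth p t _ _) _.
  by rewrite ler_wpM2r ?sqrtr_ge0 //; apply: le_trans (norm2_le_norm1 _) Bnu.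
have h1 : dotv mu q <= optval B q.
  apply: ub_le_sup; last by exists mu.
  by exists (dotv m q + Num.sqrt (k%:R * b) * Num.sqrt (Vwidth p t q)).
have h2 : optval B (p t) <=
    dotv m (p t) + Num.sqrt (k%:R * b) * Num.sqrt (Vwidth p t (p t)).
  apply: ge_sup; [by exists (dotv mu (p t)); exists mu | exact: Bub].
have := le_trans h1 (le_trans (choice q Cq) h2).
have := le_trans (ler_norm _) (dotv_le_Vwidth p t (m - mu) (p t)).
have := ler_wpM2r (sqrtr_ge0 (Vwidth p t (p t))) conf.
rewrite radE dotvBr dotvBl -/V -/b.
set w := Num.sqrt (Vwidth _ _ _); set x := norm2 _; lra.
Qed.

End Confidence.

(** * Vertices of the fairness polytope *)

Section Polytope.
Import numFieldNormedType.Exports.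

Lemma continuous_sumr {R : realType} {X : topologicalType} {I : Type}
    (s : seq I) (Q : pred I) (f : I -> X -> R) :
  (forall i, continuous (f i)) ->
  continuous ((fun x => \sum_(i <- s | Q i) f i x) : X -> R).
Proof.
move=> fc x; elim: s => [|i s IH].
  by under eq_fun do rewrite big_nil; exact: cvg_cst.
under eq_fun do rewrite big_cons.
by case: (Q i) => //; apply: cvgD => //; exact: fc.
Qed.

Context {R : realType} {k g : nat}.
Variables (G : 'I_g -> {set 'I_k}) (lo up : 'I_g -> R).
Local Notation C := (fairC G lo up).
Implicit Types (p q v mu : 'cV[R]_k).

Lemma fairC_le1 q : C q -> forall a, q a 0 <= 1.
Proof.
move=> [q_ge0 [<- _]] a; rewrite (bigD1 a) //= lerDl; exact: sumr_ge0.
Qed.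

Lemma fairC_dotv_le1 q : C q -> dotv q q <= 1.
Proof.
move=> Cq; have [q_ge0 [q1 _]] := Cq; rewrite -[leRHS]q1 ler_sum // => a _.
by rewrite ler_piMr // fairC_le1.
Qed.

Lemma fairC_neq0 q : C q -> q != 0.
Proof.
move=> [_ [+ _]]; apply: contra_eq_neq => ->.
by rewrite big1 ?(eq_sym 0) ?oner_eq0 // => a _; rewrite mxE.
Qed.

Lemma fairC_dotv_ge0 mu q : (forall a, 0 <= mu a 0) -> C q -> 0 <= dotv mu q.
Proof. by move=> mu0 [q0 _]; apply: sumr_ge0 => a _; rewrite mulr_ge0. Qed.

Lemma fairC_dotv_mu_le1 mu q : (forall a, mu a 0 <= 1) -> C q -> dotv mu q <= 1.
Proof.
by move=> mu1 [q0 [<- _]]; apply: ler_sum => a _; rewrite ler_piMl.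
Qed.

(** A closed subset of the unit cube, in row vectors so that [rV_compact] applies. *)
Lemma fairC_compact : compact [set v : 'rV[R]_k | C v^T].
Proof.
pose S (Q : pred 'I_k) (v : 'rV[R]_k) := \sum_(a | Q a) v 0 a.
have Sc Q : continuous (S Q) by apply: continuous_sumr => a; exact: coord_continuous.
have SE Q (v : 'rV[R]_k) : \sum_(a | Q a) v^T a 0 = S Q v by apply: eq_bigr => a _; rewrite mxE.
apply: (@subclosed_compact _ _ [set v : 'rV[R]_k | forall a, `[0, 1]%classic (v 0 a)]).
- have -> : [set v : 'rV[R]_k | C v^T] =
     (\bigcap_a (fun v : 'rV[R]_k => v 0 a) @^-1` [set x | 0 <= x]) `&`
     (S xpredT @^-1` [set x | x = 1] `&`
      \bigcap_i (S (mem (G i)) @^-1` [set x | lo i <= x] `&`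
                 S (mem (G i)) @^-1` [set x | x <= up i])).
    rewrite eqEsubset; split => v.
      move=> [v0 [v1 vG]]; split; first by move=> a _ /=; have := v0 a; rewrite mxE.
      split; first by rewrite /= -SE.
      by move=> i _; have := vG i; rewrite SE => /andP[].
    move=> [v0 [v1 vG]]; split; first by move=> a; rewrite mxE; exact: v0.
    split; first by rewrite SE.
    by move=> i; have [h1 h2] := vG i Logic.I; rewrite SE; apply/andP.
  apply: closedI; last apply: closedI.
  + apply: closed_bigI => a _; apply: preimage_closed; last exact: closed_ge.
    by move=> v _; exact: coord_continuous.
  + by apply: preimage_closed; [move=> v _; exact: Sc|exact: closed_eq].
  + apply: closed_bigI => i _; apply: closedI.
      by apply: preimage_closed; [move=> v _; exact: Sc|exact: closed_ge].
    by apply: preimage_closed; [move=> v _; exact: Sc|exact: closed_le].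
- by have := @rV_compact R k (fun=> `[0, 1]%classic) (fun=> @segment_compact _ 0 1).
- move=> v Cv a; have [v0 _] := Cv.
  have := fairC_le1 _ Cv a; have := v0 a; rewrite !mxE => h1 h2.
  by rewrite /= in_itv /= h1 h2.
Qed.

(* Among the maximizers of [mu], one of largest Euclidean norm is a vertex, by
   strict convexity of the squared norm. *)
Lemma vertex_maximizer mu p : C p -> (forall q, C q -> dotv mu q <= dotv mu p) ->
  exists2 v, vertex C v & dotv mu v = dotv mu p.
Proof.
move=> Cp pmax.
pose f (v : 'rV[R]_k) := \sum_a mu a 0 * v 0 a.
have fE (v : 'rV[R]_k) : dotv mu v^T = f v by apply: eq_bigr => a _; rewrite mxE.
pose n (v : 'rV[R]_k) := \sum_a v 0 a * v 0 a.
have nE (v : 'rV[R]_k) : dotv v^T v^T = n v by apply: eq_bigr => a _; rewrite mxE.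
have fc : continuous f.
  apply: continuous_sumr => a v.
  exact: (@continuousM R _ (fun=> mu a 0) (fun u : 'rV[R]_k => u 0 a) v
    (@cst_continuous _ _ _ v) (@coord_continuous _ _ _ 0 a v)).
have nc : continuous n.
  apply: continuous_sumr => a v.
  exact: (@continuousM R _ (fun u : 'rV[R]_k => u 0 a) (fun u => u 0 a) v
    (@coord_continuous _ _ _ 0 a v) (@coord_continuous _ _ _ 0 a v)).
pose K := [set v : 'rV[R]_k | C v^T] `&` f @^-1` [set x | dotv mu p <= x].
have cK : compact K.
  apply: compact_closedI; first exact: fairC_compact.
  by apply: preimage_closed; [move=> v _; exact: fc|exact: closed_ge].
have K0 : K !=set0 by exists p^T; rewrite /K /= -fE trmxK.
have [c /set_mem[Cc fcge] cmax] :=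
  EVT_max_rV K0 cK (continuous_subspaceT nc).
have optK q : C q -> dotv mu p <= dotv mu q -> dotv q q <= dotv c^T c^T.
  move=> Cq qmu; have := cmax q^T; rewrite -!nE trmxK; apply; apply/mem_set.
  by split; rewrite /= ?trmxK // -fE trmxK.
have cp : dotv mu c^T = dotv mu p.
  by apply/eqP; rewrite eq_le pmax // fE.
exists c^T => //; split => // x y Cx Cy l /andP[l0 l1] cE.
(* Neither value exceeds the maximum, and a proper convex combination of them attains it. *)
have [mx my] : dotv mu x = dotv mu p /\ dotv mu y = dotv mu p.
  have hx := pmax x Cx; have hy := pmax y Cy.
  move: cp; rewrite cE dotvDr !dotvZr => h.
  by split; apply/eqP; rewrite eq_le ?hx ?hy /=; nra.
have nx : dotv x x <= dotv c^T c^T by apply: optK => //; rewrite mx.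
have ny : dotv y y <= dotv c^T c^T by apply: optK => //; rewrite my.
(* Since [|c|^2 = l a + (1 - l) b - l (1 - l) |x - y|^2] and [a, b <= |c|^2], the last term is at
   most 0. *)
apply/subr0_eq/dotv_eq0/eqP; rewrite eq_le dotv_ge0 andbT.
move: nx ny; rewrite cE dotvBl !dotvBr dotvDl !dotvDr !dotvZl !dotvZr (dotvC y x).
set a := dotv x x; set b := dotv y y; set m := dotv x y => nx ny.
have l2 : 0 < l * (1 - l) by rewrite mulr_gt0 // subr_gt0.
rewrite -(ler_pM2l l2) mulr0.
have l1' : 0 <= 1 - l by rewrite subr_ge0 ltW.
have := ler_wpM2l (ltW l0) nx; have := ler_wpM2l l1' ny; lra.
Qed.

Lemma gap_le1 mu v : (forall a, 0 <= mu a 0 <= 1) -> C v -> gap C mu v <= 1.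
Proof.
move=> mu01 Cv; rewrite /gap lerBlDr; apply: (@le_trans _ _ 1).
  by apply: fairC_dotv_mu_le1 Cv => a; case/andP: (mu01 a).
rewrite lerDl; set S := [set dotv mu v' | v' in _].
(* Without a second vertex the supremum takes the default value 0; otherwise it dominates a
   nonnegative value. *)
have [->|/set0P[x Sx]] := eqVneq S set0; first by rewrite sup0.
have [v' [[Cv' _] _] xE] := Sx.
apply: (@le_trans _ _ x).
  by rewrite -xE; apply: fairC_dotv_ge0 => // a; case/andP: (mu01 a).
apply: ub_le_sup Sx; exists 1 => _ [w [[Cw _] _] <-].
by apply: fairC_dotv_mu_le1 Cw => a; case/andP: (mu01 a).
Qed.

Lemma gap_le mu v w : (forall a, 0 <= mu a 0 <= 1) -> vertex C w -> w <> v ->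
  gap C mu v <= dotv mu v - dotv mu w.
Proof.
move=> mu01 Vw wv; rewrite /gap lerB //; apply: ub_le_sup; last by exists w.
exists 1 => _ [u [[Cu _] _] <-].
by apply: fairC_dotv_mu_le1 Cu => a; case/andP: (mu01 a).
Qed.

End Polytope.

Lemma fairC_dim1 {R : realType} {k g : nat} (G : 'I_g -> {set 'I_k})
    (lo up : 'I_g -> R) (p q : 'cV[R]_k) :
  k = 1%N -> fairC G lo up p -> fairC G lo up q -> p = q.
Proof.
move=> k1; rewrite {k}k1 in G p q *.
move=> [_ [+ _]] [_ [+ _]]; rewrite !big_ord1 => p1 q1.
by apply/colP => i; rewrite ord1 p1 q1.
Qed.

(** * The determinant of the design matrix *)

Section DetSplit.
Context {R : realType} {k : nat}.
Variables (p : nat -> 'cV[R]_k) (v : 'cV[R]_k) (T : nat).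
Hypothesis p_le1 : forall s, (1 <= s <= T)%N -> dotv (p s) (p s) <= 1.

Definition mismatches : R := \sum_(1 <= s < T.+1) (p s != v)%:R.

Lemma mismatches_ge0 : 0 <= mismatches.
Proof. by apply: sumr_ge0. Qed.

Lemma matches_mismatches :
  \sum_(1 <= s < T.+1) (p s == v)%:R + mismatches = T%:R.
Proof.
rewrite -big_split /= (eq_bigr (fun=> 1)) => [|s _]; last first.
  by case: (p s == v); rewrite ?addr0 ?add0r.
by rewrite sumr_const_nat subn1.
Qed.

Lemma mismatches_le : mismatches <= T%:R.
Proof. by rewrite -matches_mismatches lerDr sumr_ge0. Qed.

(* AM-GM for [Q V Q], where [Q] shrinks the direction of [v] by [c]. *)
Lemma det_Vmat_shrink c : v != 0 -> dotv v v <= 1 -> 0 < c <= 1 -> (0 < k)%N ->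
  c ^+ 2 * \det (Vmat p T.+1) <= ((k%:R - 1 + mismatches
    + c ^+ 2 * (1 + (T%:R - mismatches))) / k%:R) ^+ k.
Proof.
move=> v0 v1 /andP[c0 c1] k0; set q := dotv v v in v1 *.
have q0 : 0 < q.
  rewrite lt_neqAle dotv_ge0 andbT eq_sym; apply: contra_neq v0.
  exact: dotv_eq0.
(* This makes [Q] multiply [v] by [c] and fix its orthogonal complement. *)
pose a := (1 - c) / q.
have aq : a * q = 1 - c by rewrite /a divfK ?gt_eqF.
have a_ge0 : 0 <= a by rewrite divr_ge0 ?subr_ge0 // ltW.
pose Q : 'M[R]_k := 1%:M + (- a *: v) *m v^T.
have Qsym : Q^T = Q.
  by rewrite /Q raddfD /= trmx1 -scalemxAl linearZ /= trmx_mul trmxK.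
have QE x : Q *m x = x - (a * dotv v x) *: v.
  by rewrite /Q mulmxDl mul1mx mul_col_rowE scalerA mulrN scaleNr mulrC.
have detQ : \det Q = c by rewrite /Q det1D_rank1 dotvZr -/q mulNr aq; ring.
have Qnorm x : dotv (Q *m x) (Q *m x) = dotv x x - a * (1 + c) * dotv v x ^+ 2.
  rewrite QE dotvBl !dotvBr !dotvZl !dotvZr -/q (dotvC x v).
  have -> : 1 + c = 2 - a * q by rewrite aq; ring.
  by ring.
set V := Vmat p T.+1.
have psdQ : psdmx (Q *m V *m Q).
  split; first by rewrite !trmx_mul Qsym tr_Vmat mulmxA.
  move=> x; rewrite -!mulmxA mulmxA -[in X in X *m _]Qsym -trmx_mul.
  by rewrite -dotvE (le_trans (dotv_ge0 _) (Vmat_ge _ _ _)).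
have trQ : \tr (Q *m V *m Q) = k%:R - 1 + c ^+ 2
    + \sum_(1 <= s < T.+1) dotv (Q *m p s) (Q *m p s).
  rewrite /V /Vmat mulmxDr mulmxDl mxtraceD mulmx1; congr (_ + _).
    have vQ : v^T *m Q = c *: v^T.
      rewrite -Qsym -trmx_mul QE -/q aq -{1}[v]scale1r -scalerBl.
      by rewrite opprB addrC subrK linearZ.
    rewrite {1}/Q mulmxDl mul1mx -mulmxA vQ -scalemxAr -scalemxAl scalerA.
    rewrite /Q -scalemxAl !mxtraceD mxtrace1 !mxtraceZ mxtrace_mulC mulmx_dotv.
    by rewrite mxtrace_scalar -/q mulr1n (_ : c = 1 - a * q); [ring|rewrite aq; ring].
  rewrite mulmx_sumr mulmx_suml raddf_sum; apply: eq_bigr => s _ /=.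
  by rewrite mulmxA -mulmxA -[in X in _ *m X]Qsym -trmx_mul mxtrace_mulC
    mulmx_dotv mxtrace_scalar.
have -> : c ^+ 2 * \det V = \det (Q *m V *m Q).
  by rewrite !det_mulmx detQ; ring.
(* A round at [v] contributes at most [c ^+ 2] to the trace; any other contributes at most 1, since
   [Q] is a contraction. *)
have term_le s : (1 <= s < T.+1)%N ->
    dotv (Q *m p s) (Q *m p s) <= c ^+ 2 * (p s == v)%:R + (p s != v)%:R.
  move=> sT; rewrite Qnorm; have [->|_] /= := eqVneq (p s) v.
    rewrite -/q mulr1 addr0.
    have -> : q - a * (1 + c) * q ^+ 2 = q * c ^+ 2.
      have -> : q - a * (1 + c) * q ^+ 2 = q * (1 - (1 + c) * (a * q)) by ring.
      by rewrite aq; ring.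
    by rewrite ler_piMl // sqr_ge0.
  rewrite mulr0 add0r; apply: le_trans (p_le1 s sT).
  by rewrite gerBl mulr_ge0 ?sqr_ge0 // mulr_ge0 // addr_ge0 // ltW.
have tr_le : \tr (Q *m V *m Q) <= k%:R - 1 + mismatches
    + c ^+ 2 * (1 + (T%:R - mismatches)).
  rewrite trQ -matches_mismatches addrK.
  have : \sum_(1 <= s < T.+1) dotv (Q *m p s) (Q *m p s) <=
      c ^+ 2 * \sum_(1 <= s < T.+1) (p s == v)%:R + mismatches.
    by rewrite mulr_sumr -big_split /= ler_sum_nat.
  by set m := \sum_(1 <= s < T.+1) (_ == _)%:R; lra.
apply: le_trans (det_le_tr _ _ k0 psdQ) _.
have tr_ge0 : 0 <= \tr (Q *m V *m Q).
  have k1 : 1 <= k%:R :> R by rewrite ler1n.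
  have s0 : 0 <= \sum_(1 <= s < T.+1) dotv (Q *m p s) (Q *m p s).
    by apply: sumr_ge0 => s _; exact: dotv_ge0.
  by rewrite trQ; have := sqr_ge0 c; lra.
apply: lerXn2r; rewrite ?nnegrE.
- by rewrite divr_ge0.
- by rewrite divr_ge0 // (le_trans tr_ge0).
- by rewrite ler_wpM2r ?invr_ge0.
Qed.

(** The choice [c^2 = b / M] makes the mean in the shrunk bound exactly [b], which gives [M b^(k-1)]
    with [M <= 1 + T]. It requires [b <= M]; otherwise [c = 1] gives [b^k], and [b <= 1 + T]. *)
Lemma det_Vmat_split : v != 0 -> dotv v v <= 1 -> (1 < k)%N ->
  \det (Vmat p T.+1) <= (1 + T%:R) * (1 + mismatches / (k%:R - 1)) ^+ k.-1.
Proof.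
move=> v0 v1 k1; set N := mismatches; set V := Vmat p T.+1.
pose n : R := k%:R - 1.
have n_ge1 : 1 <= n by rewrite /n lerBrDr -[1 + 1]/(2%:R) ler_nat.
have n0 : 0 < n by apply: lt_le_trans n_ge1.
have kE : k%:R = n + 1 by rewrite subrK.
have N0 : 0 <= N := mismatches_ge0; have NT : N <= T%:R := mismatches_le.
pose M : R := 1 + (T%:R - N).
have M1 : 1 <= M by rewrite lerDl subr_ge0.
pose b := 1 + N / n.
have b1 : 1 <= b by rewrite lerDl divr_ge0 // ltW.
have b0 : 0 < b by apply: lt_le_trans b1.
have bT : b <= 1 + T%:R.
  by rewrite lerD2l (le_trans _ NT) // ler_pdivrMr // ler_peMr.
have nbE : n + N = n * b by rewrite /b mulrDr mulr1 mulrCA divff ?gt_eqF // mulr1.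
have powE : b ^+ k = b * b ^+ k.-1 by rewrite -exprS prednK // ltnW.
have shrink c : 0 < c <= 1 ->
    c ^+ 2 * \det V <= ((n * b + c ^+ 2 * M) / (n + 1)) ^+ k.
  move=> c01; rewrite -nbE -kE.
  by apply: det_Vmat_shrink => //; exact: ltnW.
rewrite -/n -/b; have [bM|Mb] := leP b M.
  have M0 : 0 < M := lt_le_trans b0 bM.
  have c1 : Num.sqrt (b / M) <= 1.
    by rewrite -[leRHS]sqrtr1 ler_wsqrtr // ler_pdivrMr // mul1r.
  have := shrink (Num.sqrt (b / M)).
  rewrite sqrtr_gt0 divr_gt0 // c1 sqr_sqrtr ?(ltW (divr_gt0 _ _)) // => /(_ isT).
  rewrite divfK ?gt_eqF // -{3}[b]mul1r -mulrDl [_ * b / _]mulrAC.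
  rewrite divff ?mul1r; last by rewrite gt_eqF // addr_gt0.
  rewrite powE -mulrA ler_pM2l // mulrC ler_pdivrMr // => h.
  apply: le_trans h _; rewrite mulrC ler_wpM2r ?(exprn_ge0 _ (ltW b0)) //.
  by rewrite /M lerD2l gerBl.
have := shrink 1; rewrite ltr01 lexx expr1n !mul1r => /(_ isT) h.
apply: le_trans h _; apply: (@le_trans _ _ (b ^+ k)).
  have n10 : 0 < n + 1 by rewrite addr_gt0.
  apply: lerXn2r; rewrite ?nnegrE ?(ltW b0) //.
    rewrite divr_ge0 ?(ltW n10) // addr_ge0 ?(le_trans ler01 M1) //.
    by rewrite mulr_ge0 ?(ltW n0) ?(ltW b0).
  by rewrite ler_pdivrMr //; move: Mb; lra.
by rewrite powE ler_wpM2r ?(exprn_ge0 _ (ltW b0)).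
Qed.

End DetSplit.

(** * Numerical inequalities *)

Section Numeric.
Context {R : realType}.
Implicit Types x y z : R.

Lemma ln1D_ge z : 0 <= z -> z / (1 + z) <= ln (1 + z).
Proof.
move=> z0; have z1 : 0 < 1 + z by lra.
have e : 1 + - (z / (1 + z)) = (1 + z)^-1 by field; rewrite gt_eqF.
have : ln (1 + - (z / (1 + z))) <= - (z / (1 + z)).
  by apply: le_ln1Dx; rewrite ltrN2 ltr_pdivrMr // mul1r; lra.
by rewrite e lnV ?posrE // lerN2.
Qed.

Lemma expR_le_inv z : z < 1 -> expR z <= (1 - z)^-1.
Proof.
move=> z1; rewrite -[z]opprK expRN opprK lef_pV2 ?posrE ?expR_gt0 ?subr_gt0 //.
exact: expR_ge1Dx.
Qed.

(** [1 + 1/n] is the inverse of [1 - 1/(n+1)]. Powers of this bound yield the numerical values for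
    [expR] and [ln] below. *)
Lemma expR_invn_le (n : nat) : (0 < n)%N -> expR (n.+1%:R^-1) <= 1 + n%:R^-1 :> R.
Proof.
move=> n0; have inv_inv (m : R) : 0 < m -> 1 + m^-1 = (1 - (m + 1)^-1)^-1.
  by move=> m0; field; rewrite !gt_eqF //; lra.
rewrite inv_inv ?ltr0n // natr1.
by apply: expR_le_inv; rewrite invf_lt1 // ltr1n.
Qed.

Lemma expR_le_exprn (n m : nat) : (0 < n)%N ->
  expR (m%:R / n.+1%:R) <= (1 + n%:R^-1) ^+ m :> R.
Proof.
move=> n0; rewrite expRM_natl.
by rewrite lerXn2r ?nnegrE ?expR_ge0 ?addr_ge0 ?invr_ge0 // expR_invn_le.
Qed.

Lemma expR1_le3 : expR 1 <= 3 :> R.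
Proof.
rewrite (_ : 1 = 16%:R / 16%:R); last by rewrite divff ?pnatr_eq0.
by apply: le_trans (expR_le_exprn 15 16 isT) _; lra.
Qed.

Lemma ln2_ge : 2 / 3 <= ln 2 :> R.
Proof.
rewrite -ler_expR lnK ?posrE // (_ : 2 / 3 = 16%:R / 24%:R); last by field.
by apply: le_trans (expR_le_exprn 23 16 isT) _; lra.
Qed.

(** Concavity of [ln] between 1 and 2, with [ln 2 >= 2/3]. *)
Lemma le_ln1D x : 0 <= x <= 1 -> x <= 3 / 2 * ln (1 + x).
Proof.
move=> /andP[x0 x1].
have := @concave_ln R (Itv01 x0 x1) 2 1 (ltr0Sn _ _) ltr01.
rewrite !convRE /= ln1 mulr0 addr0 mulr1.
have -> : x * 2 + (1 - x) = 1 + x by ring.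
have := ler_wpM2l x0 ln2_ge; lra.
Qed.

Lemma expR_natr_le (n : nat) x : x <= n%:R -> expR x <= 3 ^+ n.
Proof.
move=> xn; apply: (@le_trans _ _ (expR n%:R)); first by rewrite ler_expR.
rewrite -[n%:R]mulr1 expRM_natl.
by rewrite lerXn2r ?nnegrE ?expR_ge0 // expR1_le3.
Qed.

(** On the pieces starting at 1/2, 1 and 3 the exponential is at most 3, 27 and 243, which is
    already enough. *)
Lemma expR_le_quadratic x : 1 / 2 <= x <= 9 / 2 ->
  39 / 10 * (2 * expR x - 1) <= 256 * x ^+ 2.
Proof.
move=> /andP[x_ge x_le].
have [x1|x1] := lerP x 1; [|have [x3|x3] := lerP x 3].
- by have := expR_natr_le 1 _ x1; rewrite expr1; nra.
- by have := expR_natr_le 3 _ x3; nra.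
- have x5 : x <= 5 by lra.
  by have := expR_natr_le 5 _ x5; nra.
Qed.

(* A horizon with few expected plays per arm: [N <= T] is enough. *)
Lemma mismatch_bound_short (k T : nat) (Y s N : R) :
  (1 < k)%N -> (0 < T)%N -> N <= T%:R -> 1 <= s ->
  k%:R * ln (1 + T%:R / k%:R) <= Y -> Y <= 9 ->
  39 / 10 * (1 + N / (k%:R - 1)) <= 64 * s * Y ^+ 2.
Proof.
move=> k1 T0 NT s1 Y_ge Y9.
have k2 : 2 <= k%:R :> R by rewrite ler_nat.
have k0 : 0 < k%:R :> R by lra.
have T1 : 1 <= T%:R :> R by rewrite ler1n.
have n0 : 0 < k%:R - 1 :> R by lra.
set x := ln _ in Y_ge.
have x_ge : T%:R / (k%:R + T%:R) <= x.
  have -> : T%:R / (k%:R + T%:R) = (T%:R / k%:R) / (1 + T%:R / k%:R) :> R.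
    by field; rewrite !gt_eqF //; lra.
  by apply: ln1D_ge; rewrite divr_ge0.
have x0 : 0 <= x by apply: le_trans x_ge; rewrite divr_ge0 // ltW //; lra.
have x2 : x <= 9 / 2 by nra.
have Y0 : 0 <= Y by apply: le_trans Y_ge; rewrite mulr_ge0.
suff h : 39 / 10 * (1 + T%:R / (k%:R - 1)) <= 64 * Y ^+ 2.
  have : 39 / 10 * (1 + N / (k%:R - 1)) <= 39 / 10 * (1 + T%:R / (k%:R - 1)).
    by rewrite ler_wpM2l // lerD2l ler_wpM2r // invr_ge0 ltW.
  have := sqr_ge0 Y; nra.
(* For [k <= T] the ratio [T / k] is [expR x - 1] with [x >= 1/2], and the quadratic bound applies.
   For [T < k] the left side is at most [39 / 5], while [Y >= 1/2]. *)
have [kT|Tk] := leqP k T.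
- have kT' : k%:R <= T%:R :> R by rewrite ler_nat.
  have x12 : 1 / 2 <= x.
    by apply: le_trans x_ge; rewrite ler_pdivlMr; lra.
  have xE : expR x = 1 + T%:R / k%:R by rewrite lnK // posrE addr_gt0 ?divr_gt0 //; lra.
  have Tn : T%:R / (k%:R - 1) <= 2 * (T%:R / k%:R) :> R.
    have TE : T%:R / k%:R * k%:R = T%:R :> R by rewrite divfK ?gt_eqF.
    have : 0 <= T%:R / k%:R :> R by rewrite divr_ge0.
    by rewrite ler_pdivrMr // -{2}TE; nra.
  have := expR_le_quadratic x; rewrite x12 x2 => /(_ isT); rewrite xE => h.
  have Y2x : 2 * x <= Y by apply: le_trans Y_ge; rewrite ler_wpM2r.
  have Y2 : 4 * x ^+ 2 <= Y ^+ 2 by nra.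
  by move: h Tn Y2; lra.
- have Tk' : T%:R + 1 <= k%:R :> R by rewrite natr1 ler_nat.
  have Y12 : 1 / 2 <= Y.
    apply: le_trans Y_ge; apply: le_trans (ler_wpM2l (ltW k0) x_ge).
    by rewrite mulrA ler_pdivlMr; nra.
  have : T%:R / (k%:R - 1) <= 1 :> R by rewrite ler_pdivrMr // mul1r; lra.
  by nra.
Qed.

(** For [Y <= 9] the bound [N <= T] suffices. Beyond 9, [Num.sqrt Y >= 3] absorbs the [+ 1] at the
    cost of a factor 16/9 on [Y], and [k <= 2 (k - 1)] handles the division. *)
Lemma mismatch_bound (k T : nat) (s l L N : R) :
  (1 < k)%N -> (0 < T)%N -> 0 <= N <= T%:R -> 1 <= s -> 0 <= l -> 0 <= L ->
  let Y := k%:R * ln (1 + T%:R / k%:R) + 2 * l in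
  L <= k%:R * ln (1 + T%:R / k%:R) ->
  N <= 9 / 2 * k%:R * s * L * (Num.sqrt (L + 2 * l) + 1) ^+ 2 ->
  39 / 10 * (1 + N / (k%:R - 1)) <= 64 * s * Y ^+ 2.
Proof.
move=> k1 T0 /andP[N0 NT] s1 l0 L0 Y LL NL.
have [Y9|Y9] := lerP Y 9.
  by apply: mismatch_bound_short NT s1 _ Y9 => //; rewrite /Y; lra.
have k2 : 2 <= k%:R :> R by rewrite ler_nat.
have n0 : 0 < k%:R - 1 :> R by lra.
have LY : L + 2 * l <= Y by rewrite /Y; lra.
have L_le : L <= Y by lra.
set r := Num.sqrt Y.
have r3 : 3 <= r.
  rewrite (_ : 3 = Num.sqrt (3 ^+ 2)); last by rewrite sqrtr_sqr ger0_norm.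
  by rewrite ler_wsqrtr //; lra.
have rY : r ^+ 2 = Y by rewrite sqr_sqrtr //; lra.
have h1 : (Num.sqrt (L + 2 * l) + 1) ^+ 2 <= 16 / 9 * Y.
  have h : Num.sqrt (L + 2 * l) <= r by rewrite ler_wsqrtr.
  have := sqrtr_ge0 (L + 2 * l); rewrite -rY; nra.
have h2 : N <= 8 * k%:R * s * Y ^+ 2.
  apply: le_trans NL _.
  have -> : 8 * k%:R * s * Y ^+ 2 = 9 / 2 * k%:R * s * Y * (16 / 9 * Y) by field.
  apply: ler_pM => //; rewrite ?sqr_ge0 //; last by rewrite ler_wpM2l // !mulr_ge0 //; lra.
  by rewrite !mulr_ge0 //; lra.
have h3 : N / (k%:R - 1) <= 16 * s * Y ^+ 2.
  rewrite ler_pdivrMr //; apply: le_trans h2 _.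
  have : 0 <= s * Y ^+ 2 by rewrite mulr_ge0 ?sqr_ge0 //; lra.
  nra.
have Y81 : 81 <= Y ^+ 2 by nra.
have : 81 <= s * Y ^+ 2 by nra.
lra.
Qed.

(* [2 exp(9/16) <= 39/10] absorbs both [1 + T <= 2 T] and the constant [9/16]. *)
Lemma logdet_bound (k T : nat) (s Y L N : R) :
  (1 < k)%N -> (0 < T)%N -> 0 <= N -> 0 < s -> 0 < Y ->
  L <= ln ((1 + T%:R) * (1 + N / (k%:R - 1)) ^+ k.-1) ->
  39 / 10 * (1 + N / (k%:R - 1)) <= 64 * s * Y ^+ 2 ->
  L + 9 / 16 <= ln T%:R + (k%:R - 1) * ln (64 * s) + 2 * (k%:R - 1) * ln Y.
Proof.
move=> k1 T0 N0 s0 Y0 LN NY.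
have k2 : 2 <= k%:R :> R by rewrite ler_nat.
have n0 : 0 < k%:R - 1 :> R by lra.
have kE : k.-1%:R = k%:R - 1 :> R.
  by rewrite -[in RHS](prednK (ltnW k1)) -natr1 addrK.
have T1 : 1 <= T%:R :> R by rewrite ler1n.
have b1 : 1 <= 1 + N / (k%:R - 1) by rewrite lerDl divr_ge0 // ltW.
set b := 1 + N / _ in LN NY b1.
have b0 : 0 < b := lt_le_trans ltr01 b1.
clearbody b.
have lnT : ln (1 + T%:R) <= ln 2 + ln T%:R :> R.
  rewrite -lnM ?posrE //; last by lra.
  by rewrite ler_ln ?posrE; lra.
have p39 : 0 < 39 / 10 :> R by lra.
have e916 : 9 / 16 + ln 2 <= ln (39 / 10) :> R.
  rewrite -ler_expR expRD !lnK ?posrE //.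
  have : expR (9 / 16) <= 39 / 20 :> R.
    rewrite (_ : 9 / 16 = 2%:R / 4%:R + 1%:R / 16%:R); last by field.
    rewrite expRD.
    have h1 : expR (2%:R / 4%:R) <= (1 + 3^-1) ^+ 2 :> R := expR_le_exprn 3 2 isT.
    have h2 : expR (1%:R / 16%:R) <= (1 + 15^-1) ^+ 1 :> R := expR_le_exprn 15 1 isT.
    have := ler_pM (expR_ge0 _) (expR_ge0 _) h1 h2; lra.
  lra.
have lnb : ln (39 / 10) + ln b <= ln (64 * s) + 2 * ln Y.
  have -> : 2 * ln Y = ln (Y ^+ 2) by rewrite lnXn // mulr_natl.
  have Y2 : 0 < Y ^+ 2 by rewrite exprn_gt0.
  have s64 : 0 < 64 * s by rewrite mulr_gt0.
  by rewrite -!lnM ?posrE // ler_ln ?posrE ?mulr_gt0.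
have ln39 : 0 <= ln (39 / 10) :> R by rewrite ln_ge0 //; lra.
apply: le_trans (_ : ln (1 + T%:R) + (k%:R - 1) * ln b + 9 / 16 <= _).
  rewrite lerD2r; apply: le_trans LN _.
  have T10 : 0 < 1 + T%:R :> R by lra.
  rewrite lnM ?posrE ?exprn_gt0 //.
  by rewrite lnXn // -[ln b *+ _]mulr_natl kE.
have n1 : 1 <= k%:R - 1 :> R by lra.
(* As [k - 1 >= 1], one of the [k - 1] copies of [ln (39 / 10)] pays for [ln 2] and [9 / 16]. *)
have h1 : ln (39 / 10) <= (k%:R - 1) * ln (39 / 10) :> R by rewrite ler_peMl.
have h2 := ler_wpM2l (ltW n0) lnb.
move: h1 h2; set x := ln (39 / 10) in e916 *; nra.
Qed.

(** The bound on [N] feeds the determinant estimate and gives [y + 9 / 16 <= X + 2 l]; the regret is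
    then estimated through [y]. The factor [sigma] is pulled out first, by
    [q + sigma <= sigma (q + 1)]. *)
Lemma regret_bound (k T : nat) (sigma gam l L N Reg : R) :
  (1 < k)%N -> (0 < T)%N -> 1 <= sigma -> 0 < gam <= 1 -> 0 < l -> 0 <= L ->
  0 <= N <= T%:R ->
  L <= k%:R * ln (1 + T%:R / k%:R) ->
  L <= ln ((1 + T%:R) * (1 + N / (k%:R - 1)) ^+ k.-1) ->
  let S := 9 / 2 * k%:R * (Num.sqrt (L + 2 * l) + sigma) ^+ 2 * L in
  N * gam ^+ 2 <= S -> gam * Reg <= S ->
  Reg <= (8 * k%:R * sigma ^+ 2 / gam) *
    (ln T%:R + (k%:R - 1) * ln (64 * sigma ^+ 2 / gam ^+ 2)
     + 2 * (k%:R - 1) * ln (k%:R * ln (1 + T%:R / k%:R) + 2 * l) + 2 * l) ^+ 2.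
Proof.
move=> k1 T0 sigma1 /andP[gam0 gam1] l0 L0 N0T LL LN S NS RS.
have k2 : 2 <= k%:R :> R by rewrite ler_nat.
set y := L + 2 * l in S NS RS; set q := Num.sqrt y in S NS RS.
have y0 : 0 < y by rewrite /y; lra.
have q0 : 0 <= q by exact: sqrtr_ge0.
have qq : q ^+ 2 = y by rewrite sqr_sqrtr // ltW.
have beta_le : (q + sigma) ^+ 2 <= sigma ^+ 2 * (q + 1) ^+ 2.
  rewrite -exprMn lerXn2r ?nnegrE //; [lra|nra|nra].
have S_le : S <= 9 / 2 * k%:R * (sigma ^+ 2 * (q + 1) ^+ 2) * L.
  by rewrite /S ler_wpM2r // ler_wpM2l //; lra.
set s := sigma ^+ 2 / gam ^+ 2.
have gam2 : 0 < gam ^+ 2 by rewrite exprn_gt0.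
have s1 : 1 <= s by rewrite /s ler_pdivlMr //; nra.
have NS' : N <= 9 / 2 * k%:R * s * L * (q + 1) ^+ 2.
  rewrite -(ler_pM2r gam2); apply: le_trans NS _; apply: le_trans S_le _.
  rewrite le_eqVlt; apply/orP; left; apply/eqP; rewrite /s; field.
  by rewrite gt_eqF.
have := @mismatch_bound k T s l L N k1 T0 N0T s1 (ltW l0) L0 LL NS'.
set Y := _ + 2 * l; rewrite -[64 * _ / _]mulrA -/s => hY.
have Y0 : 0 < Y by rewrite /Y; lra.
case/andP: N0T => N0 NT.
have := logdet_bound k T s Y L N k1 T0 N0 (lt_le_trans ltr01 s1) Y0 LN hY.
set X := _ + _ + 2 * _ * _ => X_ge.
rewrite -(ler_pM2l gam0); apply: le_trans RS _; apply: le_trans S_le _.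
have -> : gam * (8 * k%:R * sigma ^+ 2 / gam * (X + 2 * l) ^+ 2)
    = 9 / 2 * k%:R * sigma ^+ 2 * (16 / 9 * (X + 2 * l) ^+ 2).
  by field; rewrite gt_eqF.
have -> : 9 / 2 * k%:R * (sigma ^+ 2 * (q + 1) ^+ 2) * L
    = 9 / 2 * k%:R * sigma ^+ 2 * ((q + 1) ^+ 2 * L) by ring.
have k92 : 0 <= 9 / 2 * k%:R :> R by lra.
apply: ler_wpM2l; first by rewrite mulr_ge0 ?sqr_ge0.
(* This is [(q - 3 / 2)^2 >= 0], the source of the constant [9 / 16]. Squaring it, with [L <= q^2],
   produces the leading constant [9/2 * 16/9 = 8]. *)
have h : (q + 1) * q <= 4 / 3 * (y + 9 / 16).
  have := sqr_ge0 (q - 3 / 2); rewrite -qq; lra.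
apply: (@le_trans _ _ ((4 / 3 * (y + 9 / 16)) ^+ 2)).
  apply: (@le_trans _ _ (((q + 1) * q) ^+ 2)).
    by rewrite exprMn ler_wpM2l ?sqr_ge0 // qq /y; lra.
  have h0 : 0 <= (q + 1) * q by rewrite mulr_ge0 // addr_ge0.
  by rewrite lerXn2r ?nnegrE // (le_trans h0).
have -> : 16 / 9 * (X + 2 * l) ^+ 2 = (4 / 3 * (X + 2 * l)) ^+ 2 by field.
have yX : y + 9 / 16 <= X + 2 * l by rewrite /y; lra.
by apply: lerXn2r; rewrite ?nnegrE; lra.
Qed.

End Numeric.

(** * The self-normalized supermartingale *)

Section SubSigmaAlgebra.
Context {d} {Omega : measurableType d} {R : realType} (P : probability Omega R).
Local Notation leb := (@lebesgue_measure R).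

Section Transfer.
Variable S : set (set Omega).
Hypotheses (S_sigma : sigma_algebra setT S) (S_sub : S `<=` measurable).
Local Notation OmegaS := (g_sigma_algebraType S).

Lemma measurable_g_sigma : @measurable _ OmegaS = S.
Proof. exact: sigma_algebra_id. Qed.

Lemma sub_measurable_fun d' (U : measurableType d') (f : Omega -> U) :
  measurable_fun setT (f : OmegaS -> U) -> measurable_fun setT f.
Proof.
move=> mf _ B mB; rewrite setTI; apply: S_sub.
by have := mf measurableT B mB; rewrite setTI measurable_g_sigma.
Qed.

Lemma adapted_measurable_fun d' (U : measurableType d') (f : Omega -> U) :
  (forall B, measurable B -> S (f @^-1` B)) -> measurable_fun setT (f : OmegaS -> U).
Proof. by move=> mf _ B mB; rewrite setTI measurable_g_sigma; exact: mf. Qed.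

End Transfer.

Definition below_graph (W : Omega -> R) (x : Omega * R) : R :=
  \1_[set x : Omega * R | 0 <= x.2 < W x.1] x.

Lemma measurable_below_graph W : measurable_fun setT W -> measurable_fun setT (below_graph W).
Proof.
move=> mW; apply: measurable_indic.
have := @measurable_and _ _ setT (fun x : Omega * R => 0 <= x.2) (fun x => x.2 < W x.1).
have m1 : measurable_fun setT (fun x : Omega * R => 0 <= x.2).
  by apply: measurable_fun_ler; [exact: measurable_cst|exact: measurable_snd].
have m2 : measurable_fun setT (fun x : Omega * R => x.2 < W x.1).
  apply: measurable_fun_ltr; first exact: measurable_snd.
  exact: (measurableT_comp mW measurable_fst).
by move=> /(_ m1 m2 measurableT [set true] I); rewrite setTI.
Qed.

Lemma measurable_below_graphM W h : measurable_fun setT W -> measurable_fun setT h ->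
  measurable_fun setT (fun x : Omega * R => (below_graph W x * h x.1)%:E).
Proof.
move=> mW mh; apply/measurable_EFinP; apply: measurable_funM.
  exact: measurable_below_graph.
exact: (measurableT_comp mh measurable_fst).
Qed.

Lemma below_graph_ge0 W x : 0 <= below_graph W x.
Proof. by rewrite /below_graph indicE ler0n. Qed.

(** Tonelli, after writing [W w] as the length of the interval [[0, W w[]. *)
Lemma layer_cake (W h : Omega -> R) :
  (forall w, 0 <= W w) -> (forall w, 0 <= h w) ->
  measurable_fun setT W -> measurable_fun setT h ->
  (\int[P]_w (W w * h w)%:E = \int[leb]_s \int[P]_w (below_graph W (w, s) * h w)%:E)%E.
Proof.
move=> W0 h0 mW mh.
pose f (x : Omega * R) := (below_graph W x * h x.1)%:E.
have f0 x : (0 <= f x)%E by rewrite lee_fin mulr_ge0 ?below_graph_ge0.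
rewrite -[RHS](fubini_tonelli (m1 := P) (m2 := leb) f (measurable_below_graphM _ _ mW mh) f0).
apply: eq_integral => w _.
rewrite (_ : (fun y => f (w, y)) = (fun y => (h w)%:E * (\1_(`[0, W w[%classic : set R) y)%:E)%E);
    last first.
  apply/funext => y; rewrite /f -EFinM mulrC /below_graph !indicE.
  by congr (_ * _%:R)%:E; apply/idP/idP => /set_mem h1; apply/mem_set; move: h1;
    rewrite /= in_itv.
rewrite ge0_integralZl_EFin //.
- rewrite integral_indic // setIT.
  rewrite mulrC EFinM; congr (_ * _)%E; apply/esym.
  rewrite [LHS](lebesgue_measure_itv `[0, W w[) /= lte_fin.
  by case: ltgtP (W0 w) => // [W1 _|<- _ //]; rewrite -EFinD subr0.
- by apply/measurable_EFinP; exact: measurable_indic.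
Qed.

(** This plays the part of pulling an [S]-measurable factor out of a conditional expectation: the
    layer-cake formula reduces [W] to indicators of its superlevel sets, which belong to [S]. *)
Lemma sub_weighted_integral (S : set (set Omega)) (K : R) (W h : Omega -> R) :
  sigma_algebra setT S -> S `<=` measurable -> 0 <= K ->
  (forall w, 0 <= W w) -> (forall w, 0 <= h w) -> measurable_fun setT h ->
  measurable_fun setT (W : g_sigma_algebraType S -> R) ->
  (forall A, S A -> \int[P]_(w in A) (h w)%:E <= K%:E * P A)%E ->
  (\int[P]_w (W w * h w)%:E <= \int[P]_w (W w * K)%:E)%E.
Proof.
move=> S_sigma S_sub K0 W0 h0 mh mWS hA.
have mW : measurable_fun setT W := sub_measurable_fun _ S_sigma S_sub _ _ _ mWS.
rewrite !layer_cake //; apply: ge0_le_integral => //.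
- move=> s _; apply: integral_ge0 => w _; by rewrite lee_fin mulr_ge0 ?below_graph_ge0.
- apply: (measurable_fun_fubini_tonelli_G (m1 := P) (fun x => (below_graph W x * h x.1)%:E)).
    exact: measurable_below_graphM.
  by move=> x; rewrite lee_fin mulr_ge0 ?below_graph_ge0.
- apply: (measurable_fun_fubini_tonelli_G (m1 := P) (fun x => (below_graph W x * K)%:E)).
    exact: (measurable_below_graphM W (fun=> K)).
  by move=> x; rewrite lee_fin mulr_ge0 ?below_graph_ge0.
move=> s _; pose A := [set w | 0 <= s < W w].
have SA : S A.
  rewrite -(measurable_g_sigma _ S_sigma).
  have := @measurable_and _ (g_sigma_algebraType S) setT (fun=> 0 <= s)
    (fun w => s < W w) (measurable_cst _)
    (measurable_fun_ltr (measurable_cst _) mWS) measurableT [set true] I.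
  by rewrite setTI.
have mA : measurable A := S_sub _ SA.
have uE (f : Omega -> R) : (fun w => (below_graph W (w, s) * f w)%:E) = (EFin \o f) \_ A.
  by apply/funext => w; rewrite epatch_indic /= -EFinM mulrC.
rewrite !uE -!integral_mkcond; apply: le_trans (hA _ SA) _.
by rewrite /comp integral_cst.
Qed.

End SubSigmaAlgebra.

(** * Measurability of inverses, roots and the Gaussian density *)

Section PositiveMeasurable.
Context {d} {X : measurableType d} {R : realType}.
Implicit Types f a c : X -> R.

Lemma measurable_fun_inv_gt0 f : measurable_fun setT f -> (forall x, 0 < f x) ->
  measurable_fun setT (fun x => (f x)^-1).
Proof.
move=> mf f0; rewrite (_ : (fun x => _) = (fun x => f x `^ (-1))).
  exact: (measurableT_comp (measurable_powR _) mf).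
by apply/funext => x; rewrite powR_inv1 // ltW.
Qed.

Lemma measurable_fun_sqrt_ge0 f : measurable_fun setT f -> (forall x, 0 <= f x) ->
  measurable_fun setT (fun x => Num.sqrt (f x)).
Proof.
move=> mf f0; rewrite (_ : (fun x => _) = (fun x => f x `^ 2^-1)).
  exact: (measurableT_comp (measurable_powR _) mf).
by apply/funext => x; rewrite powR12_sqrt.
Qed.

(** The normal density parametrized by its variance [v], written out so that joint measurability in
    all arguments can be read off. *)
Definition gaussian (m v x : R) : R :=
  (Num.sqrt (v * pi * 2))^-1 * expR (- (x - m) ^+ 2 / (v * 2)).

Lemma gaussian_normal_pdf m v x : 0 < v ->
  gaussian m v x = normal_pdf m (Num.sqrt v) x.
Proof.
move=> v0; rewrite normal_pdfE ?gt_eqF ?sqrtr_gt0 //.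
by rewrite /gaussian !mulr_natr /normal_peak /normal_fun sqr_sqrtr // ltW.
Qed.

Lemma gaussian_ge0 m v x : 0 <= gaussian m v x.
Proof. by rewrite mulr_ge0 ?invr_ge0 ?sqrtr_ge0 ?expR_ge0. Qed.

Lemma measurable_gaussian (m v l : X -> R) :
  measurable_fun setT m -> measurable_fun setT v -> measurable_fun setT l ->
  (forall x, 0 < v x) -> measurable_fun setT (fun x => gaussian (m x) (v x) (l x)).
Proof.
move=> mm mv ml v0; have pi0 := pi_gt0 R; apply: measurable_funM.
  apply: measurable_fun_inv_gt0 => [|x]; last by rewrite sqrtr_gt0 !mulr_gt0.
  apply: measurable_fun_sqrt_ge0 => [|x]; last by rewrite ltW // !mulr_gt0.
  by do 2 (apply: measurable_funM; last exact: measurable_cst).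
apply: (measurableT_comp (@measurable_expR R)); apply: measurable_funM.
  apply: measurable_funN; apply: measurable_funX.
  by apply: measurable_funB.
apply: measurable_fun_inv_gt0 => [|x]; last by rewrite mulr_gt0.
by apply: measurable_funM => //; exact: measurable_cst.
Qed.

End PositiveMeasurable.

(** * Gaussian mixtures of the exponential noise factors *)

Section Mixture.
Context {R : realType}.
Local Notation leb := (@lebesgue_measure R).

Definition mixture (a c e : R) : R :=
  (Num.sqrt (1 + c))^-1 * expR ((2 * e * a + e ^+ 2 * c - a ^+ 2) / (2 * (1 + c))).

Lemma mixture_ge0 a c e : 0 <= mixture a c e.
Proof. by rewrite mulr_ge0 ?invr_ge0 ?sqrtr_ge0 ?expR_ge0. Qed.

(* Completing the square. *)
Lemma gaussian_tilt (a c e l : R) : 0 < c ->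
  gaussian a c l * expR (l * e - l ^+ 2 / 2)
  = mixture a c e * gaussian ((a + c * e) / (1 + c)) (c / (1 + c)) l.
Proof.
move=> c0; have c1 : 0 < 1 + c by rewrite addr_gt0.
rewrite /gaussian /mixture -[LHS]mulrA -expRD [RHS]mulrACA -expRD -invfM.
rewrite -sqrtrM ?(ltW c1) //.
congr (_^-1 * expR _).
  by congr Num.sqrt; field; rewrite gt_eqF.
by field; rewrite !gt_eqF.
Qed.

Lemma integral_gaussian (m v : R) : 0 < v ->
  (\int[leb]_l (gaussian m v l)%:E = 1)%E.
Proof.
move=> v0; rewrite -(integral_normal_pdf m (Num.sqrt v)).
by apply: eq_integral => l _; rewrite gaussian_normal_pdf.
Qed.

Lemma measurable_gaussian1 (m v : R) : 0 < v ->
  measurable_fun setT (fun l => (gaussian m v l)%:E).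
Proof.
move=> v0; apply/measurable_EFinP.
exact: (@measurable_gaussian _ (measurableTypeR R) R _ _ id
  (measurable_cst m) (measurable_cst v) (@measurable_id _ _ _) (fun=> v0)).
Qed.

Lemma integral_gaussian_scale (m v b : R) : 0 < v -> 0 <= b ->
  (\int[leb]_l (b * gaussian m v l)%:E = b%:E)%E.
Proof.
move=> v0 b0.
rewrite (_ : (fun l => _) = (fun l => b%:E * (gaussian m v l)%:E)%E) //.
rewrite ge0_integralZl_EFin ?integral_gaussian ?mule1 //.
- by move=> l _; rewrite lee_fin gaussian_ge0.
- exact: measurable_gaussian1.
Qed.

Lemma integral_gaussian_tilt (a c e b : R) : 0 < c -> 0 <= b ->
  (\int[leb]_l (b * gaussian a c l * expR (l * e - l ^+ 2 / 2))%:E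
    = (b * mixture a c e)%:E)%E.
Proof.
move=> c0 b0; under eq_integral do rewrite -mulrA gaussian_tilt // mulrA.
rewrite integral_gaussian_scale ?mulr_ge0 ?mixture_ge0 //.
by rewrite divr_gt0 // addr_gt0.
Qed.

(** Write the mixture as an integral over [l] and exchange integrals. At fixed [l] the weight is
    [S]-measurable and the exponential factor integrates to at most [P A'] over each [A'] in [S];
    integrating the density back over [l] leaves [M]. *)
Lemma mixture_supermartingale {d} {Omega : measurableType d}
    (P : probability Omega R) (S : set (set Omega)) (M a c e : Omega -> R) :
  sigma_algebra setT S -> S `<=` measurable ->
  measurable_fun setT (M : g_sigma_algebraType S -> R) ->
  measurable_fun setT (a : g_sigma_algebraType S -> R) ->
  measurable_fun setT (c : g_sigma_algebraType S -> R) ->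
  measurable_fun setT e ->
  (forall w, 0 <= M w) -> (forall w, 0 < c w) ->
  (forall A, S A -> forall l,
    \int[P]_(w in A) (expR (l * e w))%:E <= (expR (l ^+ 2 / 2))%:E * P A)%E ->
  forall A, S A ->
  (\int[P]_(w in A) (M w * mixture (a w) (c w) (e w))%:E
    <= \int[P]_(w in A) (M w)%:E)%E.
Proof.
move=> S_sigma S_sub mM ma mc me M0 c0 subg A SA.
pose B w := M w * \1_A w.
have B0 w : 0 <= B w by rewrite mulr_ge0 // indicE ler0n.
have mBS : measurable_fun setT (B : g_sigma_algebraType S -> R).
  apply: measurable_funM => //; apply: measurable_indic.
  by rewrite measurable_g_sigma.
have toOmega (f : Omega -> R) :
    measurable_fun setT (f : g_sigma_algebraType S -> R) -> measurable_fun setT f.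
  exact: sub_measurable_fun.
have mB : measurable_fun setT B by exact: toOmega.
have ma' : measurable_fun setT a by exact: toOmega.
have mc' : measurable_fun setT c by exact: toOmega.
pose H (l : R) w := expR (l * e w - l ^+ 2 / 2).
have mH : measurable_fun setT (fun x : Omega * R => H x.2 x.1).
  apply: (measurableT_comp (@measurable_expR R)); apply: measurable_funB.
    apply: measurable_funM; first exact: measurable_snd.
    exact: (measurableT_comp me measurable_fst).
  apply: measurable_funM; last exact: measurable_cst.
  exact: (measurable_funX _ measurable_snd).
pose W (l : R) w := B w * gaussian (a w) (c w) l.
have W0 l w : 0 <= W l w by rewrite mulr_ge0 // gaussian_ge0.
have mW : measurable_fun setT (fun x : Omega * R => W x.2 x.1).
  apply: measurable_funM; first exact: (measurableT_comp mB measurable_fst).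
  exact: (measurable_gaussian (a \o fst) (c \o fst) (snd : Omega * R -> R)
    (measurableT_comp ma' measurable_fst) (measurableT_comp mc' measurable_fst)
    measurable_snd (fun x => c0 x.1)).
have BE f : (\int[P]_(w in A) (M w * f w)%:E = \int[P]_w (B w * f w)%:E)%E.
  rewrite integral_mkcond epatch_indic; apply: eq_integral => w _.
  by rewrite /= -EFinM /B mulrAC.
have B1 : (\int[P]_(w in A) (M w)%:E = \int[P]_w (B w)%:E)%E.
  by rewrite integral_mkcond epatch_indic.
rewrite BE B1.
pose F (x : Omega * R) := (W x.2 x.1 * H x.2 x.1)%:E.
pose F1 (x : Omega * R) := (W x.2 x.1 * 1)%:E.
have mF : measurable_fun setT F by apply/measurable_EFinP; exact: measurable_funM.
have mF1 : measurable_fun setT F1.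
  apply/measurable_EFinP; apply: measurable_funM => //; exact: measurable_cst.
have F0 x : (0 <= F x)%E by rewrite lee_fin mulr_ge0 // expR_ge0.
have F10 x : (0 <= F1 x)%E by rewrite lee_fin mulr_ge0.
have -> : (\int[P]_w (B w * mixture (a w) (c w) (e w))%:E
    = \int[P]_w \int[leb]_l F (w, l))%E.
  apply: eq_integral => w _; rewrite -integral_gaussian_tilt //.
have -> : (\int[P]_w (B w)%:E = \int[P]_w \int[leb]_l F1 (w, l))%E.
  apply: eq_integral => w _; rewrite /F1 /=; under eq_integral do rewrite mulr1.
  exact/esym/(integral_gaussian_scale _ _ _ (c0 w) (B0 w)).
rewrite (fubini_tonelli (m1 := P) (m2 := leb) F mF F0).
rewrite (fubini_tonelli (m1 := P) (m2 := leb) F1 mF1 F10).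
apply: ge0_le_integral => //.
- by move=> l _; apply: integral_ge0.
- exact: (measurable_fun_fubini_tonelli_G (m1 := P) F mF F0).
- exact: (measurable_fun_fubini_tonelli_G (m1 := P) F1 mF1 F10).
move=> l _; apply: (@sub_weighted_integral _ _ _ P S 1 (W l) (H l)) => //.
- by move=> w; exact: expR_ge0.
- apply: (measurableT_comp (@measurable_expR R)); apply: measurable_funB => //.
  by apply: measurable_funM => //; exact: measurable_cst.
- apply: measurable_funM => //.
  exact: (@measurable_gaussian _ (g_sigma_algebraType S) R a c (fun=> l)
    ma mc (measurable_cst l) c0).
move=> A' SA'; rewrite mul1e.
have -> : (\int[P]_(w in A') (H l w)%:E =
    (expR (- (l ^+ 2 / 2)))%:E * \int[P]_(w in A') (expR (l * e w))%:E)%E.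
  rewrite -ge0_integralZl_EFin ?expR_ge0 //.
  - by apply: eq_integral => w _; rewrite -EFinM -expRD addrC.
  - exact: S_sub.
  - apply/measurable_EFinP; apply: (measurable_funS measurableT) => //.
    apply: (measurableT_comp (@measurable_expR R)).
    by apply: measurable_funM => //; exact: measurable_cst.
apply: (@le_trans _ _ ((expR (- (l ^+ 2 / 2)))%:E * ((expR (l ^+ 2 / 2))%:E * P A'))%E).
  by rewrite lee_wpmul2l ?subg // lee_fin expR_ge0.
by rewrite muleA -EFinM -expRD addNr expR0 mul1e.
Qed.

End Mixture.

(** * Measurability of matrix-valued maps *)

Section MatrixMeasurable.
Context {d} {X : measurableType d} {R : realType}.

Definition measurable_mx {m n} (A : X -> 'M[R]_(m, n)) :=
  forall i j, measurable_fun setT (fun x => A x i j).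

Lemma measurable_mxD m n (A B : X -> 'M[R]_(m, n)) :
  measurable_mx A -> measurable_mx B -> measurable_mx (fun x => A x + B x).
Proof.
move=> mA mB i j; under eq_fun do rewrite mxE.
by apply: measurable_funD; [exact: mA|exact: mB].
Qed.

Lemma measurable_mxZ m n (a : X -> R) (A : X -> 'M[R]_(m, n)) :
  measurable_fun setT a -> measurable_mx A -> measurable_mx (fun x => a x *: A x).
Proof.
move=> ma mA i j; under eq_fun do rewrite mxE.
by apply: measurable_funM => //; exact: mA.
Qed.

Lemma measurable_mxT m n (A : X -> 'M[R]_(m, n)) :
  measurable_mx A -> measurable_mx (fun x => (A x)^T).
Proof. by move=> mA i j; under eq_fun do rewrite mxE; exact: mA. Qed.

Lemma measurable_mxM m n q (A : X -> 'M[R]_(m, n)) (B : X -> 'M[R]_(n, q)) :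
  measurable_mx A -> measurable_mx B -> measurable_mx (fun x => A x *m B x).
Proof.
move=> mA mB i j; under eq_fun do rewrite mxE.
by apply: measurable_sum => l; apply: measurable_funM; [exact: mA|exact: mB].
Qed.

Lemma measurable_det n (A : X -> 'M[R]_n) :
  measurable_mx A -> measurable_fun setT (fun x => \det (A x)).
Proof.
move=> mA; apply: measurable_sum => s; apply: measurable_funM.
  exact: measurable_cst.
by apply: measurable_prod => i _; exact: mA.
Qed.

(** Cramer's rule: the adjugate over the determinant, whose positivity keeps [invmx] off its default
    branch. *)
Lemma measurable_invmx n (A : X -> 'M[R]_n) : measurable_mx A ->
  (forall x, 0 < \det (A x)) -> measurable_mx (fun x => invmx (A x)).
Proof.
move=> mA A0 i j.
have -> : (fun x => invmx (A x) i j) = (fun x => ((\det (A x))^-1 *: \adj (A x)) i j).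
  by apply/funext => x; rewrite /invmx unitmxE unitfE gt_eqF.
apply: measurable_mxZ; first exact/measurable_fun_inv_gt0/A0/measurable_det.
move=> {}i {}j; under eq_fun do rewrite mxE; apply: measurable_funM.
  exact: measurable_cst.
apply: measurable_det => i' j'; under eq_fun do rewrite !mxE; exact: mA.
Qed.

Lemma measurable_dotv n (u v : X -> 'cV[R]_n) : measurable_mx u -> measurable_mx v ->
  measurable_fun setT (fun x => dotv (u x) (v x)).
Proof.
move=> mu mv; apply: measurable_sum => i.
by apply: measurable_funM; [exact: mu|exact: mv].
Qed.

End MatrixMeasurable.

(** * The recursion of the self-normalized process *)

Section Martingale.
Context {R : realType} {k : nat}.
Implicit Types (p : nat -> 'cV[R]_k) (r : nat -> R) (mu y : 'cV[R]_k).

Definition selfnorm mu p r t : R :=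
  expR (Vwidth p t (noise_sum mu p r t) / 2) / Num.sqrt (\det (Vmat p t)).

Lemma selfnorm_ge0 mu p r t : 0 <= selfnorm mu p r t.
Proof. by rewrite divr_ge0 ?expR_ge0 ?sqrtr_ge0. Qed.

Lemma selfnorm1 mu p r : selfnorm mu p r 1 = 1.
Proof.
rewrite /selfnorm /Vwidth /noise_sum Vmat1 det1 sqrtr1 big_geq // mulmx0.
by rewrite /dotv big1 ?mul0r ?expR0 ?divr1 // => i _; rewrite mxE mul0r.
Qed.

(** Sherman-Morrison lowers the width of any [z] by [(dotv (p t) (W *m z))^2 / (1 + c)]; at
    [z = y + e p_t] the squared quantity is [a + e c]. *)
Lemma Vwidth_step p t y e : (0 < t)%N ->
  let a := dotv (p t) (invmx (Vmat p t) *m y) in let c := Vwidth p t (p t) in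
  Vwidth p t.+1 (y + e *: p t)
    = Vwidth p t y + (2 * e * a + e ^+ 2 * c - a ^+ 2) / (1 + c).
Proof.
move=> t0 a c; have c1 : 1 + c != 0 by rewrite gt_eqF // ltr_pwDl ?Vwidth_ge0.
set W := invmx (Vmat p t) in a *; have WT : W^T = W := tr_invVmat p t.
have step z : Vwidth p t.+1 z = Vwidth p t z - (1 + c)^-1 * dotv (p t) (W *m z) ^+ 2.
  rewrite /Vwidth VmatS // invmx_add_rank1 ?Vmat_unit // -/W -/(Vwidth p t (p t)) -/c.
  rewrite mulmxBl dotvBr -scalemxAl dotvZr -!mulmxA mulmx_dotv mul_mx_scalar
    -scalemxAr.
  by rewrite dotvZr (dotv_mulmxr W z (p t)) WT (dotvC (W *m z)) -expr2.
rewrite step /Vwidth -/W !mulmxDr -!scalemxAr !dotvDl !dotvDr !dotvZl !dotvZr.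
have -> : dotv y (W *m p t) = a by rewrite dotv_mulmxr WT dotvC.
by rewrite -/a -/(Vwidth p t (p t)) -/c; field.
Qed.

Lemma selfnormS mu p r t : (0 < t)%N ->
  selfnorm mu p r t.+1 = selfnorm mu p r t * mixture
    (dotv (p t) (invmx (Vmat p t) *m noise_sum mu p r t)) (Vwidth p t (p t))
    (noise mu p r t).
Proof.
move=> t0; have c1 : 0 < 1 + Vwidth p t (p t) by rewrite ltr_pwDl ?Vwidth_ge0.
rewrite /selfnorm /mixture noise_sumS // Vwidth_step // det_VmatS //.
rewrite sqrtrM ?(ltW (det_Vmat_gt0 _ _)) // invfM mulrDl expRD.
rewrite [X in expR X / _ * _]/=.
set A := expR (_ / 2); set s := _^-1; set s' := _^-1; set E := (_ - _).
have -> : E / (2 * (1 + Vwidth p t (p t))) = E / (1 + Vwidth p t (p t)) / 2.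
  by field; rewrite gt_eqF.
ring.
Qed.

Lemma selfnorm_le mu p r t delta : 0 < delta -> selfnorm mu p r t <= delta^-1 ->
  Vwidth p t (noise_sum mu p r t) <= 2 * ln (Num.sqrt (\det (Vmat p t)) / delta).
Proof.
move=> delta0; have s0 : 0 < Num.sqrt (\det (Vmat p t)).
  by rewrite sqrtr_gt0 det_Vmat_gt0.
rewrite /selfnorm ler_pdivrMr // [_ * Num.sqrt _]mulrC.
rewrite -(ler_ln (x := expR _)) ?posrE ?expR_gt0 ?divr_gt0 // expRK.
by rewrite ler_pdivrMr //; lra.
Qed.

End Martingale.

(** * The maximal inequality for nonnegative supermartingales *)

Section Maximal.
Context {d} {Omega : measurableType d} {R : realType} (P : probability Omega R).
Variables (F : nat -> set (set Omega)) (M : nat -> Omega -> R) (N : nat).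
Hypotheses (F_sigma : forall n, sigma_algebra setT (F n))
  (F_sub : forall n, F n `<=` measurable)
  (F_mono : forall m n, (m <= n)%N -> F m `<=` F n).
Hypotheses (M_meas : forall n, (n <= N)%N ->
    measurable_fun setT (M n : g_sigma_algebraType (F n) -> R))
  (M_ge0 : forall n w, 0 <= M n w) (M0 : forall w, M 0%N w = 1).
Hypothesis M_step : forall n, (n < N)%N -> forall A, F n A ->
  (\int[P]_(w in A) (M n.+1 w)%:E <= \int[P]_(w in A) (M n w)%:E)%E.

(** Ville's inequality on a finite horizon, by induction on an invariant of the process stopped when
    it first exceeds [delta^-1]. *)
Lemma maximal_inequality delta : 0 < delta < 1 ->
  let E := [set w | forall n, (n <= N)%N -> M n w <= delta^-1] in
  measurable E /\ (P E >= (1 - delta)%:E)%E.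
Proof.
move=> /andP[d0 d1].
pose B n := [set w | forall m, (m <= n)%N -> M m w <= delta^-1].
have delta1 : 1 <= delta^-1 by rewrite invf_ge1 // ltW.
have B0 : B 0%N = setT.
  by apply/seteqP; split => // w _ m; rewrite leqn0 => /eqP ->; rewrite M0.
have level n : (n <= N)%N -> F n [set w | M n w <= delta^-1].
  move=> nN; rewrite -(measurable_g_sigma _ (F_sigma n)).
  have m := measurable_fun_ler (M_meas n nN) (measurable_cst delta^-1).
  by have := m measurableT [set true] I; rewrite setTI.
have BS n : B n.+1 = B n `&` [set w | M n.+1 w <= delta^-1].
  apply/seteqP; split => w.
    by move=> Bw; split => [m mn|]; apply: Bw => //; exact: leqW.
  by move=> [Bw Mw] m; rewrite leq_eqVlt => /orP[/eqP ->|] //; exact: Bw.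
have FI n A A' : F n A -> F n A' -> F n (A `&` A').
  by rewrite -(measurable_g_sigma _ (F_sigma n)) => *; exact: measurableI.
have FB n : (n <= N)%N -> F n (B n).
  elim: n => [_|n IH nN]; first by rewrite B0 -(measurable_g_sigma _ (F_sigma 0%N)).
  rewrite BS; apply: FI; last exact: level.
  by apply: (F_mono n n.+1 (leqnSn n)); apply: IH; exact: ltnW.
have mB n : (n <= N)%N -> measurable (B n) by move=> nN; apply: F_sub (FB n nN).
have mM n : (n <= N)%N -> measurable_fun setT (M n).
  by move=> nN; apply: (sub_measurable_fun _ (F_sigma n) (F_sub n)) (M_meas n nN).
(* The sum is a lower bound for the mean of the stopped process: on the complement of [B n] that
   process already exceeds [delta^-1]. *)
have key n : (n <= N)%N ->
    ((delta^-1)%:E * P (~` B n) + \int[P]_(w in B n) (M n w)%:E <= 1)%E.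
  elim: n => [_|n IH nN].
    rewrite B0 setCT measure0 mule0 add0e.
    by under eq_integral do rewrite M0; rewrite integral_cst // mul1e probability_le1.
  have nN' := ltnW nN; apply: le_trans (IH nN').
  (* On [D] the level is first exceeded at time [n.+1]. There [delta^-1] is below [M n.+1], so
     moving [D] to the stopped part does not increase the sum. *)
  pose D := B n `&` [set w | delta^-1 < M n.+1 w].
  have mD : measurable D.
    apply: measurableI; first exact: mB.
    have m := measurable_fun_ltr (measurable_cst delta^-1) (mM n.+1 nN).
    by have := m measurableT [set true] I; rewrite setTI.
  have BE : B n = B n.+1 `|` D.
    rewrite BS /D -setIUr; apply/seteqP; split => [w Bw|w []] //.
    by split => //=; case: (leP (M n.+1 w) delta^-1); [left|right].
  have disj : [disjoint B n.+1 & D].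
    rewrite disj_set2E; apply/eqP/seteqP; split => // w [].
    by rewrite BS => -[_ /= h1] [_ /= h2]; move: (lt_le_trans h2 h1); rewrite ltxx.
  have PC : P (~` B n.+1) = (P (~` B n) + P D)%E.
    rewrite -measureU //; [|by apply: measurableC; exact: mB|].
      congr (P _); rewrite BS setCI; apply/seteqP; split => w [nB|]; try by left.
        have [Bw|nB] := pselect (B n w); last by left.
        by move=> /negP; rewrite -ltNge; right.
      by move=> [_ /= Mw]; right => /=; apply/negP; rewrite -ltNge.
    apply/seteqP; split => // w [h1 [h2 _]]; exact: h1.
  rewrite PC ge0_muleDr // -addeA leeD2l //.
  apply: le_trans (M_step n nN _ (FB n nN')).
  rewrite BE ge0_integral_setU //; first last.
  - by move=> w _; rewrite lee_fin.
  - rewrite -BE; apply/measurable_EFinP; apply: measurable_funS (mM n.+1 nN) => //.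
  - exact: mB.
  rewrite addeC leeD2l // -integral_cst //; apply: ge0_le_integral => //.
  - by move=> w _; rewrite lee_fin (le_trans ler01).
  - apply/measurable_EFinP; apply: measurable_funS (mM n.+1 nN) => //.
  - by move=> w [_ /= h]; rewrite lee_fin ltW.
split; first exact: mB.
have := key N (leqnn N); rewrite probability_setC; last exact: mB.
have i0 : (0 <= \int[P]_(w in B N) (M N w)%:E)%E by apply: integral_ge0 => w _; rewrite lee_fin.
move=> /(le_trans (leeDl _ i0)).
rewrite -[X in (X <= 1)%E]muleC -lee_pdivlMr ?invr_gt0 // invrK mul1e.
have -> : P (B N) = (fine (P (B N)))%:E.
  by rewrite fineK // (fin_num_measure P) //; exact: mB.
by rewrite -EFinB !lee_fin; lra.
Qed.

End Maximal.

(** * Concentration of the noise, uniformly over the rounds *)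

Section Concentration.
Context {d} {Omega : measurableType d} {R : realType} {k : nat}.

(** The measurable space is arbitrary so that each sigma-algebra of the filtration can be used in
    turn. *)
Lemma measurable_Vmat d' (X : measurableType d') (p : nat -> X -> 'cV[R]_k) t :
  (forall s, (1 <= s < t)%N -> measurable_mx (p s)) ->
  measurable_mx (fun w => Vmat (fun s => p s w) t).
Proof.
elim: t => [|[|t] IH] mp i j.
- by under eq_fun do rewrite /Vmat big_geq // addr0; exact: measurable_cst.
- by under eq_fun do rewrite Vmat1; exact: measurable_cst.
under eq_fun do rewrite VmatS //; apply: measurable_mxD.
  by apply: IH => s /andP[s1 st]; apply: mp; rewrite s1 ltnW.
have mpt : measurable_mx (p t.+1) by apply: mp; rewrite ltnSn.
by apply: measurable_mxM => //; exact: measurable_mxT.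
Qed.

Lemma measurable_noise d' (X : measurableType d') (mu : 'cV[R]_k)
    (p : nat -> X -> 'cV[R]_k) (r : nat -> X -> R) t :
  measurable_mx (p t) -> measurable_fun setT (r t) ->
  measurable_fun setT (fun w => noise mu (fun s => p s w) (fun s => r s w) t).
Proof.
by move=> mp mr; apply: measurable_funB => //; apply: measurable_dotv.
Qed.

Lemma measurable_noise_sum d' (X : measurableType d') (mu : 'cV[R]_k)
    (p : nat -> X -> 'cV[R]_k) (r : nat -> X -> R) t :
  (forall s, (1 <= s < t)%N -> measurable_mx (p s)) ->
  (forall s, (1 <= s < t)%N -> measurable_fun setT (r s)) ->
  measurable_mx (fun w => noise_sum mu (fun s => p s w) (fun s => r s w) t).
Proof.
elim: t => [|[|t] IH] mp mr i j.
- by under eq_fun do rewrite /noise_sum big_geq //; exact: measurable_cst.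
- by under eq_fun do rewrite /noise_sum big_geq //; exact: measurable_cst.
under eq_fun do rewrite noise_sumS //; apply: measurable_mxD.
  by apply: IH => s /andP[s1 st]; [apply: mp|apply: mr]; rewrite s1 ltnW.
have mpt : measurable_mx (p t.+1) by apply: mp; rewrite ltnSn.
by apply: measurable_mxZ => //; apply: measurable_noise => //; apply: mr; rewrite ltnSn.
Qed.

Lemma measurable_bilinear d' (X : measurableType d') (p : nat -> X -> 'cV[R]_k)
    (u v : X -> 'cV[R]_k) t :
  (forall s, (1 <= s < t)%N -> measurable_mx (p s)) ->
  measurable_mx u -> measurable_mx v ->
  measurable_fun setT
    (fun w => dotv (u w) (invmx (Vmat (fun s => p s w) t) *m v w)).
Proof.
move=> mp mu mv; apply: measurable_dotv => //; apply: measurable_mxM => //.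
by apply: measurable_invmx => [|w]; [exact: measurable_Vmat|exact: det_Vmat_gt0].
Qed.

Lemma measurable_selfnorm d' (X : measurableType d') (mu : 'cV[R]_k)
    (p : nat -> X -> 'cV[R]_k) (r : nat -> X -> R) t :
  (forall s, (1 <= s < t)%N -> measurable_mx (p s)) ->
  (forall s, (1 <= s < t)%N -> measurable_fun setT (r s)) ->
  measurable_fun setT (fun w => selfnorm mu (fun s => p s w) (fun s => r s w) t).
Proof.
move=> mp mr; have mS := measurable_noise_sum _ _ mu p r t mp mr.
apply: measurable_funM.
  apply: (measurableT_comp (@measurable_expR R)); apply: measurable_funM.
    exact: measurable_bilinear.
  exact: measurable_cst.
apply: measurable_fun_inv_gt0 => [|w]; last by rewrite sqrtr_gt0 det_Vmat_gt0.
apply: measurable_fun_sqrt_ge0 => [|w]; last by rewrite ltW ?det_Vmat_gt0.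
exact/measurable_det/measurable_Vmat.
Qed.

Lemma selfnorm_concentration (P : probability Omega R) (F : nat -> set (set Omega))
    (mu : 'cV[R]_k) (r : nat -> Omega -> R) (p : nat -> Omega -> 'cV[R]_k)
    (T : nat) (delta : R) :
  (1 <= T)%N -> 0 < delta < 1 ->
  (forall t, sigma_algebra setT (F t)) -> (forall t, F t `<=` measurable) ->
  (forall s t, (s <= t)%N -> F s `<=` F t) ->
  (forall t, (1 <= t <= T)%N -> forall (B : set R), measurable B -> F t (r t @^-1` B)) ->
  (forall t, (1 <= t <= T)%N -> forall (i : 'I_k) (B : set R), measurable B ->
     F t.-1 ((fun w => p t w i 0) @^-1` B)) ->
  (forall w t, (1 <= t <= T)%N -> p t w != 0) ->
  (forall t, (1 <= t <= T)%N -> forall A, F t.-1 A -> forall lam : R,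
     (\int[P]_(w in A) (expR (lam * (r t w - dotv mu (p t w))))%:E
        <= (expR (lam ^+ 2 / 2))%:E * P A)%E) ->
  exists E : set Omega, measurable E /\ (P E >= (1 - delta)%:E)%E /\
    forall w, E w -> forall t, (1 <= t <= T)%N ->
      selfnorm mu (fun s => p s w) (fun s => r s w) t <= delta^-1.
Proof.
move=> T1 d01 F_sigma F_sub F_mono r_ad p_ad p0 subg.
(* The index is shifted: at round [n.+1] the process involves only rounds up to [n], hence is
   [F n]-measurable, and it starts at 1. *)
pose M n w := selfnorm mu (fun s => p s w) (fun s => r s w) n.+1.
have mp n s : (1 <= s <= T)%N -> (s.-1 <= n)%N ->
    measurable_mx (p s : g_sigma_algebraType (F n) -> 'cV[R]_k).
  move=> sT sn i j; apply: (adapted_measurable_fun _ (F_sigma n)) => B mB.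
  by apply: (F_mono _ _ sn); rewrite ord1; exact: p_ad.
have mr n s : (1 <= s <= T)%N -> (s <= n)%N ->
    measurable_fun setT (r s : g_sigma_algebraType (F n) -> R).
  move=> sT sn; apply: (adapted_measurable_fun _ (F_sigma n)) => B mB.
  by apply: (F_mono _ _ sn); exact: r_ad.
have past n s : (n <= T.-1)%N -> (1 <= s < n.+1)%N -> (1 <= s <= T)%N /\ (s <= n)%N.
  by move=> *; lia.
have mpp n : (n <= T.-1)%N -> forall s, (1 <= s < n.+1)%N ->
    measurable_mx (p s : g_sigma_algebraType (F n) -> 'cV[R]_k).
  by move=> nT s sn; have [? ?] := past n s nT sn; apply: mp => //; lia.
have mrr n : (n <= T.-1)%N -> forall s, (1 <= s < n.+1)%N ->
    measurable_fun setT (r s : g_sigma_algebraType (F n) -> R).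
  by move=> nT s sn; have [? ?] := past n s nT sn; apply: mr => //; lia.
have [] := @maximal_inequality _ Omega R P F M T.-1 F_sigma F_sub F_mono _ _ _ _ delta d01.
- move=> n nT.
  exact: (measurable_selfnorm _ (g_sigma_algebraType (F n)) mu p r n.+1
    (mpp n nT) (mrr n nT)).
- by move=> n w; exact: selfnorm_ge0.
- by move=> w; exact: selfnorm1.
- move=> n nT A FA.
  have tT : (1 <= n.+1 <= T)%N by lia.
  have nT' : (n <= T.-1)%N by lia.
  have mpt := mp n n.+1 tT (leqnn n).
  have e_meas : measurable_fun setT
      (fun w => noise mu (fun s => p s w) (fun s => r s w) n.+1).
    apply: (sub_measurable_fun _ (F_sigma n.+1) (F_sub n.+1)).
    apply: (measurable_noise _ (g_sigma_algebraType (F n.+1)) mu p r).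
      by apply: mp.
    by apply: mr.
  rewrite /M; under eq_integral do rewrite selfnormS //.
  apply: (mixture_supermartingale P (F n) (M n)
    (fun w => dotv (p n.+1 w) (invmx (Vmat (fun s => p s w) n.+1) *m
       noise_sum mu (fun s => p s w) (fun s => r s w) n.+1))
    (fun w => Vwidth (fun s => p s w) n.+1 (p n.+1 w))
    (fun w => noise mu (fun s => p s w) (fun s => r s w) n.+1)
    (F_sigma n) (F_sub n)) => //.
  + exact: (measurable_selfnorm _ (g_sigma_algebraType (F n)) mu p r n.+1
      (mpp n nT') (mrr n nT')).
  + apply: (measurable_bilinear _ (g_sigma_algebraType (F n)) p _ _ _ (mpp n nT') mpt).
    exact: (measurable_noise_sum _ (g_sigma_algebraType (F n)) mu p r n.+1
      (mpp n nT') (mrr n nT')).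
  + exact: (measurable_bilinear _ (g_sigma_algebraType (F n)) p _ _ _ (mpp n nT') mpt mpt).
  + by move=> w; exact: selfnorm_ge0.
  (* A nonzero play keeps the mixing variance positive, so the Gaussian is nondegenerate. *)
  + by move=> w; apply: Vwidth_gt0; exact: p0.
  + by move=> A' FA' l; exact: subg.
move=> mE PE; exists [set w | forall n, (n <= T.-1)%N -> M n w <= delta^-1].
split => //; split => // w Ew t /andP[t1 tT].
by have := Ew t.-1; rewrite /M prednK //; apply; lia.
Qed.

End Concentration.

(** * The regret bound *)

Section Regret.
Context {R : realType} {k g : nat}.
Variables (T : nat) (G : 'I_g -> {set 'I_k}) (lo up : 'I_g -> R).
Variables (mu vstar pstar : 'cV[R]_k) (sigma delta : R).
Variables (p : nat -> 'cV[R]_k) (r : nat -> R).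
Local Notation C := (fairC G lo up).
Hypotheses (k1 : (1 < k)%N) (T0 : (0 < T)%N) (mu01 : forall a, 0 <= mu a 0 <= 1).
Hypotheses (sigma1 : 1 <= sigma) (mu_le : norm2 mu <= sigma).
Hypotheses (Vv : vertex C vstar)
  (v_max : forall v, vertex C v -> v <> vstar -> dotv mu v < dotv mu vstar).
Hypotheses (gap0 : 0 < gap C mu vstar).
Hypotheses (Cp : C pstar) (p_max : forall q, C q -> dotv mu q <= dotv mu pstar).
Hypothesis delta01 : 0 < delta < 1.
Hypothesis choice : forall t, (1 <= t <= T)%N -> oful_choice C delta sigma p r t.
Hypothesis conf : forall t, (1 <= t <= T)%N -> selfnorm mu p r t <= delta^-1.
Local Notation gam := (gap C mu vstar).
Local Notation L := (ln (\det (Vmat p T.+1))).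
Local Notation l := (ln (1 / delta)).
Local Notation w t := (Vwidth p t (p t)).

(** Some vertex attains the maximum over the polytope, and the strict inequality at the other
    vertices forces it to be [vstar]. *)
Lemma dotv_pstar : dotv mu pstar = dotv mu vstar.
Proof.
have [v Vv' vE] := vertex_maximizer G lo up mu pstar Cp p_max.
have [<-//|/eqP v_neq] := eqVneq v vstar.
have := v_max v Vv' v_neq; have := p_max vstar (proj1 Vv); rewrite vE; lra.
Qed.

Lemma C_p t : (1 <= t <= T)%N -> C (p t).
Proof. by move=> tT; have [[]] := choice t tT. Qed.

Lemma round_regret_ge t : (1 <= t <= T)%N ->
  gam * (p t != vstar)%:R <= dotv mu (pstar - p t) /\
  (p t = vstar -> dotv mu (pstar - p t) = 0).
Proof.
move=> tT; rewrite dotvBr dotv_pstar; split; last by move=> ->; rewrite subrr.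
have [->|/eqP p_neq] /= := eqVneq (p t) vstar; first by rewrite mulr0 subrr.
by rewrite mulr1; apply: gap_le => //; have [] := choice t tT.
Qed.

Lemma L_ge0 : 0 <= L.
Proof. exact/ln_ge0/det_Vmat_ge1. Qed.

Lemma l_gt0 : 0 < l.
Proof.
by have /andP[d0 d1] := delta01; rewrite ln_gt0 // div1r invf_gt1.
Qed.

(** [2 ln (sqrt D / delta) = ln D + 2 l], and determinants grow with [t], so the final one serves
    all rounds. *)
Lemma sqrt_beta_le t : (1 <= t <= T)%N ->
  Num.sqrt (beta delta sigma (Vmat p t)) <= Num.sqrt (L + 2 * l) + sigma.
Proof.
move=> /andP[t1 tT]; have /andP[d0 _] := delta01.
have sigma0 : 0 <= sigma := le_trans ler01 sigma1.
rewrite /beta sqrtr_sqr ger0_norm ?addr_ge0 ?sqrtr_ge0 //.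
have D0 := det_Vmat_gt0 p t; have s0 : 0 < Num.sqrt (\det (Vmat p t)) by rewrite sqrtr_gt0.
have lnD : ln (\det (Vmat p t)) = 2 * ln (Num.sqrt (\det (Vmat p t))).
  by rewrite -{1}(sqr_sqrtr (ltW D0)) lnXn // mulr_natl.
have D_le : ln (\det (Vmat p t)) <= L.
  by rewrite ler_ln ?posrE ?det_Vmat_gt0 // det_Vmat_le // leqW.
by rewrite lerD2r ler_wsqrtr // lnM ?posrE ?invr_gt0 // div1r; lra.
Qed.

(** The constant [9 / 2] is 3 times 3/2: [(sqrt k + 1)^2 <= 3 k] for [k >= 2], and
    [w <= 3/2 ln (1 + w)] for a width at most 1. *)
Lemma round_regret_sqr t : (1 <= t <= T)%N ->
  dotv mu (pstar - p t) ^+ 2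
    <= 9 / 2 * k%:R * (Num.sqrt (L + 2 * l) + sigma) ^+ 2 * ln (1 + w t).
Proof.
move=> tT; set b := Num.sqrt _ + sigma; have /andP[d0 _] := delta01.
have sigma0 : 0 <= sigma := le_trans ler01 sigma1.
have b0 : 0 <= b by rewrite addr_ge0 ?sqrtr_ge0.
have k2 : 2 <= k%:R :> R by rewrite ler_nat.
have [reg_ge _] := round_regret_ge t tT.
have reg0 : 0 <= dotv mu (pstar - p t).
  by apply: le_trans reg_ge; rewrite mulr_ge0 // ltW.
have w0 : 0 <= w t := Vwidth_ge0 _ _ _.
have w1 : w t <= 1.
  exact: le_trans (Vwidth_le _ _ _) (fairC_dotv_le1 _ _ _ _ (C_p t tT)).
have := round_regret mu p r t delta sigma C pstar (choice t tT) Cp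
  (confidence_ellipsoid mu p r t delta sigma mu_le (selfnorm_le mu p r t delta d0 (conf t tT))).
move=> h; have sk0 : 0 <= Num.sqrt k%:R :> R := sqrtr_ge0 _.
have skk : Num.sqrt k%:R ^+ 2 = k%:R :> R by rewrite sqr_sqrtr.
have sk1 : (Num.sqrt k%:R + 1) ^+ 2 <= 3 * k%:R :> R.
  set s := Num.sqrt _ in skk sk0 *.
  (* [7 / 5] lies below [sqrt 2] and above [(1 + sqrt 3) / 2], where [(s + 1)^2 = 3 s^2]. *)
  have s75 : (7 / 5) ^+ 2 <= s ^+ 2 by rewrite skk; lra.
  have : 7 / 5 <= s by rewrite -(@ler_pXn2r _ 2) ?nnegrE.
  by rewrite -skk; nra.
have h' : dotv mu (pstar - p t) <= (Num.sqrt k%:R + 1) * b * Num.sqrt (w t).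
  apply: le_trans h _; rewrite ler_wpM2r ?sqrtr_ge0 // ler_wpM2l //.
  exact: sqrt_beta_le.
apply: (@le_trans _ _ (((Num.sqrt k%:R + 1) * b * Num.sqrt (w t)) ^+ 2)).
  by rewrite lerXn2r ?nnegrE // (le_trans reg0).
rewrite !exprMn sqr_sqrtr //.
have lw := le_ln1D (w t); rewrite w0 w1 in lw; have {}lw := lw isT.
apply: (@le_trans _ _ (3 * k%:R * b ^+ 2 * (3 / 2 * ln (1 + w t)))).
  apply: ler_pM => //; first by rewrite mulr_ge0 ?sqr_ge0.
  by rewrite ler_wpM2r ?sqr_ge0.
by rewrite le_eqVlt; apply/orP; left; apply/eqP; field.
Qed.

Lemma fair_regret_bound :
  fair_regret mu pstar p T <= (8 * k%:R * sigma ^+ 2 / gam) *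
    (ln T%:R + (k%:R - 1) * ln (64 * sigma ^+ 2 / gam ^+ 2)
     + 2 * (k%:R - 1) * ln (k%:R * ln (1 + T%:R / k%:R) + 2 * l) + 2 * l) ^+ 2.
Proof.
set N := mismatches p vstar T; set reg := fun t => dotv mu (pstar - p t).
have p_le1 s : (1 <= s <= T)%N -> dotv (p s) (p s) <= 1.
  by move=> sT; exact: fairC_dotv_le1 (C_p s sT).
have k0 : (0 < k)%N := ltnW k1.
have kR : 0 < k%:R :> R by rewrite ltr0n.
have sqr_sum : \sum_(1 <= t < T.+1) reg t ^+ 2 <=
    9 / 2 * k%:R * (Num.sqrt (L + 2 * l) + sigma) ^+ 2 * L.
  rewrite {2}ln_det_Vmat mulr_sumr ler_sum_nat // => t tT.
  exact: round_regret_sqr.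
have gam_ge0 : 0 <= gam := ltW gap0.
apply: (@regret_bound R k T sigma gam l L N) => //.
- by rewrite gap0 (gap_le1 _ _ _ _ _ mu01 (proj1 Vv)).
- exact: l_gt0.
- exact: L_ge0.
- by rewrite mismatches_ge0 mismatches_le.
(* AM-GM for the eigenvalues, with trace at most [k + T]. *)
- have D0 := det_Vmat_gt0 p T.+1.
  rewrite mulr_natl -lnXn; last by rewrite addr_gt0 ?divr_gt0 ?ltr0n.
  rewrite ler_ln ?posrE ?exprn_gt0 ?addr_gt0 ?divr_gt0 ?ltr0n //.
  apply: le_trans (det_le_tr _ _ k0 (psd_Vmat p T.+1)) _.
  rewrite tr_Vmat_sum; have S0 : 0 <= \sum_(1 <= s < T.+1) dotv (p s) (p s).
    by apply: sumr_ge0 => s _; exact: dotv_ge0.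
  have ST : \sum_(1 <= s < T.+1) dotv (p s) (p s) <= T%:R.
    apply: (@le_trans _ _ (\sum_(1 <= s < T.+1) 1)); first exact: ler_sum_nat.
    by rewrite sumr_const_nat subn1.
  apply: lerXn2r; rewrite ?nnegrE.
  + by rewrite divr_ge0 // addr_ge0.
  + by rewrite addr_ge0 // divr_ge0.
  + by rewrite mulrDl divff ?lt0r_neq0 // lerD2l ler_wpM2r ?invr_ge0.
- have Cv := proj1 Vv.
  have split_le := det_Vmat_split p vstar T p_le1 (fairC_neq0 _ _ _ _ Cv)
    (fairC_dotv_le1 _ _ _ _ Cv) k1.
  rewrite ler_ln ?posrE ?det_Vmat_gt0 //.
  exact: lt_le_trans (det_Vmat_gt0 _ _) split_le.
(* Each round away from [vstar] contributes at least [gam ^+ 2] to the sum of squares. *)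
- apply: le_trans sqr_sum; rewrite /N /mismatches mulr_suml ler_sum_nat // => t tT.
  have [+ _] := round_regret_ge t tT.
  have [_|_] := eqVneq (p t) vstar; first by rewrite mul0r sqr_ge0.
  rewrite mulr1 mul1r => reg_ge.
  by rewrite lerXn2r ?nnegrE // (le_trans gam_ge0).
(* A round regret is either 0 or at least [gam], hence [gam * reg t <= reg t ^+ 2]. *)
- apply: le_trans sqr_sum; rewrite /fair_regret mulr_sumr ler_sum_nat // => t tT.
  have [+ +] := round_regret_ge t tT; rewrite -/(reg t).
  have [-> _ /(_ erefl) ->|_] := eqVneq (p t) vstar; first by rewrite mulr0 expr0n.
  by rewrite mulr1 expr2 => reg_ge _; rewrite ler_wpM2r // (le_trans gam_ge0).
Qed.

End Regret.

(** A single concentration event covers all rounds, and at each of its points the regret bound is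
    deterministic. *)
Theorem theorem3 (R : realType) (k g T : nat)
  (G : 'I_g -> {set 'I_k}) (lo up : 'I_g -> R)
  (mustar : 'cV[R]_k) (sigma delta : R)
  (vstar pstar : 'cV[R]_k)
  (d : measure_display) (Omega : measurableType d) (P : probability Omega R)
  (F : nat -> set (set Omega))
  (r : nat -> Omega -> R) (p : nat -> Omega -> 'cV[R]_k) :
  (1 <= k)%N -> (1 <= g)%N -> (1 <= T)%N ->
  (forall i, 0 <= lo i /\ lo i <= up i /\ up i <= 1) ->
  (forall a, 0 <= mustar a 0 <= 1) ->
  1 <= sigma -> norm2 mustar <= sigma ->
  (* v* is the unique maximizer of mu*^T v over the vertices of C *)
  vertex (fairC G lo up) vstar ->
  (forall v, vertex (fairC G lo up) v -> v <> vstar ->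
     dotv mustar v < dotv mustar vstar) ->
  0 < gap (fairC G lo up) mustar vstar ->
  (* p* maximizes mu*^T p over C *)
  fairC G lo up pstar ->
  (forall q, fairC G lo up q -> dotv mustar q <= dotv mustar pstar) ->
  0 < delta < 1 ->
  (* filtration: F t is the information available after round t *)
  (forall t, sigma_algebra setT (F t)) ->
  (forall t, F t `<=` measurable) ->
  (forall s t, (s <= t)%N -> F s `<=` F t) ->
  (* r t is observed at round t; p t is determined before round t *)
  (forall t, (1 <= t <= T)%N -> forall (B : set R), measurable B -> F t (r t @^-1` B)) ->
  (forall t, (1 <= t <= T)%N -> forall (i : 'I_k) (B : set R), measurable B ->
     F t.-1 ((fun w => p t w i 0) @^-1` B)) ->
  (* the algorithm: p t is an L1-OFUL choice for every round 1 <= t <= T *)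
  (forall w t, (1 <= t <= T)%N ->
     oful_choice (fairC G lo up) delta sigma (fun s => p s w) (fun s => r s w) t) ->
  (* rewards: conditionally on the past and p t, mean mu*^T p t and
     1-sub-Gaussian noise *)
  (forall t, (1 <= t <= T)%N -> forall A, F t.-1 A ->
     (\int[P]_(w in A) (r t w - dotv mustar (p t w))%:E = 0)%E) ->
  (forall t, (1 <= t <= T)%N -> forall A, F t.-1 A -> forall lam : R,
     (\int[P]_(w in A) (expR (lam * (r t w - dotv mustar (p t w))))%:E
        <= (expR (lam ^+ 2 / 2))%:E * P A)%E) ->
  let gam := gap (fairC G lo up) mustar vstar in
  exists E : set Omega, measurable E /\ (P E >= (1 - delta)%:E)%E /\
    forall w, E w ->
      fair_regret mustar pstar (fun t => p t w) T <=
        (8 * k%:R * sigma ^+ 2 / gam) *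
        (ln T%:R + (k%:R - 1) * ln (64 * sigma ^+ 2 / gam ^+ 2)
         + 2 * (k%:R - 1) * ln (k%:R * ln (1 + T%:R / k%:R) + 2 * ln (1 / delta))
         + 2 * ln (1 / delta)) ^+ 2.
Proof.
move=> k1 _ T1 _ mu01 sigma1 mu_le Vv v_max gap0 Cp p_max delta01.
move=> F_sigma F_sub F_mono r_ad p_ad choice _ subg gam.
(* With a single arm the polytope has at most one point and the regret vanishes surely. The general
   argument divides by [k - 1]. *)
have [k2|k_le1] := ltnP 1 k; last first.
  have k_eq1 : k = 1%N by apply/eqP; rewrite eqn_leq k_le1.
  exists setT; split=> //; split.
    by rewrite probability_setT lee_fin; have /andP[d0 _] := delta01; lra.
  move=> w _; apply: (@le_trans _ _ 0); last first.
    rewrite mulr_ge0 ?sqr_ge0 // divr_ge0 ?(ltW gap0) //.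
    by rewrite mulr_ge0 ?sqr_ge0 // mulr_ge0.
  rewrite /fair_regret big_nat big1 // => t tT.
  have [[Cpt _] _] := choice w t tT.
  by rewrite dotvBr (fairC_dim1 _ _ _ _ _ k_eq1 Cpt Cp) subrr.
have p0 w t : (1 <= t <= T)%N -> p t w != 0.
  by move=> tT; have [[Cpt _] _] := choice w t tT; exact: fairC_neq0 Cpt.
have [E [mE [PE conf]]] := @selfnorm_concentration d Omega R k P F mustar r p T
  delta T1 delta01 F_sigma F_sub F_mono r_ad p_ad p0 subg.
exists E; split => //; split => // w Ew.
exact: (@fair_regret_bound R k g T G lo up mustar vstar pstar sigma delta
  (fun s => p s w) (fun s => r s w) k2 T1 mu01 sigma1 mu_le Vv v_max gap0 Cp p_max
  delta01 (choice w) (conf w Ew)).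
Qed.
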